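(* Let $k>0$, $c>0$, $\nu>0$ be constants, and let $\rho_0,u_0\in C^1(\mathbb{R})$ with $\rho_0(x)>0$ for all $x\in\mathbb{R}$ and $\int_{-\infty}^{\infty}(\rho_0(\xi)-c)\,d\xi=0$. Consider the one-dimensional damped Euler--Poisson system $$\rho_t+(\rho u)_x=0,\qquad u_t+uu_x=-k\phi_x-\nu u,\qquad -\phi_{xx}=\rho-c,$$ with initial data $\rho(x,0)=\rho_0(x)$, $u(x,0)=u_0(x)$. Then there is finite time breakdown if and only if there exists $x\in\mathbb{R}$ such that the following holds. (1) (Strong damping) In the case $\nu>2\sqrt{kc}$: $$\max\{u_0'(x),\ u_0'(x)+\lambda_2(c-\rho_0(x))\}<0$$ and $$\left|\frac{c\lambda_2u_0'(x)+k(c-\rho_0(x))}{k\rho_0(x)}\right|^{\lambda_1}\le\left|\frac{c\lambda_1u_0'(x)+k(c-\rho_0(x))}{k\rho_0(x)}\right|^{\lambda_2},$$ where $\lambda_1=\frac{\nu-\sqrt{\nu^2-4kc}}{2c}$ and $\lambda_2=\frac{\nu+\sqrt{\nu^2-4kc}}{2c}$. (2) (Borderline damping) In the case $\nu=2\sqrt{kc}$: $$\max\left\{u_0'(x),\ u_0'(x)+\frac{\nu}{2c}(c-\rho_0(x))\right\}<0$$ and $$\ln\left(-\frac{2cu_0'(x)+\nu(c-\rho_0(x))}{\nu\rho_0(x)}\right)\ge\frac{2cu_0'(x)}{2cu_0'(x)+\nu(c-\rho_0(x))}.$$ (3) (Weak damping) In the case $\nu<2\sqrt{kc}$: $$\left(u_0'(x)+\frac{\nu(c-\rho_0(x))}{2c}\right)^2\ge\mu^2\left[\frac{\rho_0^2(x)}{c^2}\left(\frac{kc\,e^{\nu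 t^*}}{\mu^2}-1\right)+\frac{2\rho_0(x)-c}{c}\right],$$ where $\mu=\sqrt{kc-\nu^2/4}$, $$t^*=\frac1\mu\left[\beta+\tan^{-1}\left(\frac{2\mu u_0'(x)}{\nu u_0'(x)+2k(c-\rho_0(x))}\right)\right],$$ and $$\beta=\begin{cases}0,&\nu u_0'(x)<\min\{0,2k(\rho_0(x)-c)\},\\ \pi,&2k(\rho_0(x)-c)<\nu u_0'(x),\\ 2\pi,&0<\nu u_0'(x)<2k(\rho_0(x)-c).\end{cases}$$
   Context: The solution is sought for $x\in\mathbb{R}$, $t>0$; $u_0'$ denotes the derivative of $u_0$. The neutrality condition $\int(\rho-c)\,dx=0$ is conserved in time if $\rho u$ vanishes at far fields. Solutions are $C^1$ (classical) solutions $(\rho,u)$, which exist locally in time and are unique. ''Finite time breakdown'' means that the maximal life span $T^*$ of the $C^1$ solution is finite; in that case $\lim_{t\to T^{*-}}\partial_xu=-\infty$ at some point $x^*\in\mathbb{R}$. $\tan^{-1}$ is the principal branch with values in $(-\pi/2,\pi/2)$.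
   Formalization: Local C^1 solvability (with neutrality kept in time) is a hypothesis on the data; where β, t* are undefined, t* is set to π/(2μ) or 3π/(2μ) (by continuity) if νu0'=2k(ρ0−c), and β=0 if u0'=0, ρ0>c. *)

(* Defs.v *)
From Stdlib Require Import Reals.
From Coquelicot Require Import Coquelicot.
Open Scope R_scope.

Definition is_C1 (f : R -> R) : Prop :=
  forall x, ex_derive f x /\ continuous (Derive f) x.

(* The improper integral of [f] over the whole line converges to [l]. *)
Definition is_RInt_line (f : R -> R) (l : R) : Prop :=
  is_RInt_gen f (Rbar_locally m_infty) (Rbar_locally p_infty) l.

(* Functions of space and time are written [f x t]. *)
Definition dx (f : R -> R -> R) (x t : R) : R := Derive (fun y => f y t) x.
Definition dt (f : R -> R -> R) (x t : R) : R := Derive (fun s => f x s) t.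

Definition continuous_strip (T : R) (f : R -> R -> R) : Prop :=
  forall x t, 0 <= t < T ->
    filterlim (fun p : R * R => f (fst p) (snd p))
      (within (fun p : R * R => 0 <= snd p < T) (locally (x, t)))
      (locally (f x t)).

(* C^1 on R x [0, T).  At t = 0 the time derivative is one-sided, hence the
   continuous function [ft], which agrees with [dt f] for t > 0. *)
Definition C1_strip (T : R) (f : R -> R -> R) : Prop :=
  continuous_strip T f /\
  (forall x t, 0 <= t < T -> ex_derive (fun y => f y t) x) /\
  continuous_strip T (dx f) /\
  exists ft : R -> R -> R,
    continuous_strip T ft /\
    forall x t, 0 < t < T -> is_derive (fun s => f x s) t (ft x t).

(* [(rho, u)] is a C^1 solution on R x [0, T), with potential [phi].
   The Poisson equation determines [phi_x] only up to a function of time;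
   [ep_field] fixes it, so that -phi_x (x, t) is the integral of rho - c over
   (-oo, x], and by [ep_neutral] it also vanishes at +oo. *)
Record EP_solution (k c nu : R) (rho0 u0 : R -> R) (T : R)
    (rho u phi : R -> R -> R) : Prop := {
  ep_rho_C1 : C1_strip T rho;
  ep_u_C1 : C1_strip T u;
  ep_phi_dx : forall x t, 0 < t < T -> ex_derive (fun y => phi y t) x;
  ep_phi_dxx : forall x t, 0 < t < T -> ex_derive (fun y => dx phi y t) x;
  ep_mass : forall x t, 0 < t < T ->
    dt rho x t + dx (fun y s => rho y s * u y s) x t = 0;
  ep_momentum : forall x t, 0 < t < T ->
    dt u x t + u x t * dx u x t = - k * dx phi x t - nu * u x t;
  ep_poisson : forall x t, 0 < t < T -> - dx (dx phi) x t = rho x t - c;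
  ep_neutral : forall t, 0 < t < T -> is_RInt_line (fun x => rho x t - c) 0;
  ep_field : forall t, 0 < t < T -> is_lim (fun x => dx phi x t) m_infty 0;
  ep_rho_init : forall x, rho x 0 = rho0 x;
  ep_u_init : forall x, u x 0 = u0 x
}.

Definition EP_solvable (k c nu : R) (rho0 u0 : R -> R) (T : R) : Prop :=
  0 < T /\ exists rho u phi, EP_solution k c nu rho0 u0 T rho u phi.

Definition life_span (k c nu : R) (rho0 u0 : R -> R) : Rbar :=
  Lub_Rbar (EP_solvable k c nu rho0 u0).

Definition finite_time_breakdown (k c nu : R) (rho0 u0 : R -> R) : Prop :=
  is_finite (life_span k c nu rho0 u0).

(* Below, [r] stands for rho0 x and [d] for the derivative of u0 at x. *)

Definition lambda1 (k c nu : R) : R := (nu - sqrt (nu ^ 2 - 4 * k * c)) / (2 * c).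
Definition lambda2 (k c nu : R) : R := (nu + sqrt (nu ^ 2 - 4 * k * c)) / (2 * c).

(* The first conjunct makes both bases of [Rpower] positive. *)
Definition strong_damping_condition (k c nu r d : R) : Prop :=
  let l1 := lambda1 k c nu in
  let l2 := lambda2 k c nu in
  Rmax d (d + l2 * (c - r)) < 0 /\
  Rpower (Rabs ((c * l2 * d + k * (c - r)) / (k * r))) l1
    <= Rpower (Rabs ((c * l1 * d + k * (c - r)) / (k * r))) l2.

(* The first conjunct makes the argument of [ln] positive and the denominator
   on the right nonzero. *)
Definition borderline_damping_condition (c nu r d : R) : Prop :=
  Rmax d (d + nu / (2 * c) * (c - r)) < 0 /\
  ln (- ((2 * c * d + nu * (c - r)) / (nu * r)))
    >= 2 * c * d / (2 * c * d + nu * (c - r)).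

Definition mu (k c nu : R) : R := sqrt (k * c - nu ^ 2 / 4).

(* The last two values 0 are not given by the three-case formula: they are
   reached only when nu d = 2 k (r - c), which [tstar] treats separately, or
   when d = 0 and r > c.  In the latter case 1 / rho is smallest at time 0
   along the characteristic, so that [tstar] = 0 is its first minimum. *)
Definition beta (k c nu r d : R) : R :=
  if Rlt_dec (nu * d) (Rmin 0 (2 * k * (r - c))) then 0
  else if Rlt_dec (2 * k * (r - c)) (nu * d) then PI
  else if Rlt_dec 0 (nu * d) then
    if Rlt_dec (nu * d) (2 * k * (r - c)) then 2 * PI else 0
  else 0.

(* On the line nu d = 2 k (r - c) the quotient under the arctangent has a zero
   denominator; [tstar] is extended there by its limit from either side, which
   is the same: PI / (2 mu) when d < 0 and 3 PI / (2 mu) when d > 0.  (If also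
   d = 0, then r = c and [weak_damping_condition] fails for any [tstar].) *)
Definition tstar (k c nu r d : R) : R :=
  let m := mu k c nu in
  if Req_EM_T (nu * d) (2 * k * (r - c)) then
    / m * (if Rlt_dec d 0 then PI / 2 else 3 * PI / 2)
  else
    / m * (beta k c nu r d + atan (2 * m * d / (nu * d + 2 * k * (c - r)))).

Definition weak_damping_condition (k c nu r d : R) : Prop :=
  let m := mu k c nu in
  (d + nu * (c - r) / (2 * c)) ^ 2
    >= m ^ 2 * (r ^ 2 / c ^ 2 * (k * c * exp (nu * tstar k c nu r d) / m ^ 2 - 1)
                + (2 * r - c) / c).

(* Main.v *)
Require Import Defs.
From Stdlib Require Import Reals Lra Psatz ClassicalEpsilon.
From Coquelicot Require Import Coquelicot.
Open Scope R_scope.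

(** Along a characteristic the system reduces to a damped linear oscillator.
    With E = - phi_x, the mass equation and E_x = rho - c give
    E' = - c X' up to a function of time alone, so the position satisfies
    X'' + nu X' + k c X = (a forcing).  Differentiating in the label a, the
    common part of the forcing disappears and the Jacobian w = dX/da solves
    w'' + nu w' + k c w = k rho0 (a),   w (0) = 1,   w' (0) = u0' (a),
    while rho (X (a, t), t) w (a, t) = rho0 (a).  A C^1 solution therefore keeps
    w > 0, and breakdown happens exactly when some w (a, .) has a zero at a
    positive time.

    Necessity of w > 0 ([EP_jacobian_pos]).  No ordinary differential equation
    has to be solved for the characteristics, which might a priori escape to
    infinity: the candidate X (a, t) is written down with two fundamental
    solutions y1, y2, and the defects u (X, t) - X' and E (X, t) - E_expected
    satisfy a linear homogeneous system with bounded coefficients, hence vanish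
    ([characteristics]).  The density identity is the derivative in a of the
    identity for E.

    Sufficiency ([EP_solvable_all]).  The inverse of a -> X (a, t) transports
    explicit formulas into a solution on any time interval
    ([global_solution]).  This needs more than C^1 data: rho = rho0 / w is C^1
    only if u0' is, and the neutrality of rho (., t) forces u0 to have the same
    limit at both ends.  Both properties are consequences of the existence of
    some local solution, read off at a small positive time
    ([EP_data_regular]).

    The rest is the study of one explicit function: [damping_collapse] decides,
    in each regime of roots of z^2 + nu z + k c, whether w reaches 0 by
    evaluating it at its only possible interior minimum (real roots) or at its
    first minimum, after which the energy w'^2 + k c (w - rho0 / c)^2 prevents
    a lower value (complex roots). *)

(** * Calculus of one and two real variables *)

Ltac const_pt := apply continuity_pt_const; now intros ? ?.

Lemma is_derive_eq (f : R -> R) (x l l' : R) :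
  is_derive f x l -> l = l' -> is_derive f x l'.
Proof. intros H <-; exact H. Qed.

Lemma is_derive_continuity_pt (f : R -> R) (x l : R) :
  is_derive f x l -> continuity_pt f x.
Proof.
intros H; apply continuity_pt_filterlim.
apply (ex_derive_continuous f); exists l; exact H.
Qed.

Lemma continuity_2d_pt_path (f : R -> R -> R) (g h : R -> R) (t : R) :
  continuity_2d_pt f (g t) (h t) -> continuity_pt g t -> continuity_pt h t ->
  continuity_pt (fun s => f (g s) (h s)) t.
Proof.
intros Hf Hg Hh; apply continuity_pt_filterlim.
apply (continuous_comp_2 g h f).
- now apply continuity_pt_filterlim.
- now apply continuity_pt_filterlim.
- now apply continuity_2d_pt_filterlim.
Qed.

Lemma continuity_2d_pt_comp (f g h : R -> R -> R) (x t : R) :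
  continuity_2d_pt f (g x t) (h x t) ->
  continuity_2d_pt g x t -> continuity_2d_pt h x t ->
  continuity_2d_pt (fun y s => f (g y s) (h y s)) x t.
Proof.
intros Hf Hg Hh; apply continuity_2d_pt_filterlim.
apply (continuous_comp_2 (fun p : R * R => g (fst p) (snd p))
         (fun p : R * R => h (fst p) (snd p)) f).
- now apply continuity_2d_pt_filterlim in Hg.
- now apply continuity_2d_pt_filterlim in Hh.
- now apply continuity_2d_pt_filterlim.
Qed.

Lemma continuity_2d_pt_fst (f : R -> R) (x t : R) :
  continuity_pt f x -> continuity_2d_pt (fun y _ => f y) x t.
Proof.
intros Hf; apply (continuity_1d_2d_pt_comp f (fun y _ => y)).
- exact Hf.
- apply continuity_2d_pt_id1.
Qed.

Lemma continuity_2d_pt_snd (f : R -> R) (x t : R) :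
  continuity_pt f t -> continuity_2d_pt (fun _ s => f s) x t.
Proof.
intros Hf; apply (continuity_1d_2d_pt_comp f (fun _ s => s)).
- exact Hf.
- apply continuity_2d_pt_id2.
Qed.

(** The chain rule along the path (g s, s).  Only the first partial derivative
    has to be continuous, so that the second one may be known merely at the
    point; this suits the fields below, whose time derivatives exist only for
    positive times. *)
Lemma is_derive_comp_2d (f fx : R -> R -> R) (g : R -> R) (t ft dg : R) :
  locally (g t, t) (fun p : R * R =>
    is_derive (fun y => f y (snd p)) (fst p) (fx (fst p) (snd p))) ->
  continuity_2d_pt fx (g t) t ->
  is_derive (fun s => f (g t) s) t ft ->
  is_derive g t dg ->
  is_derive (fun s => f (g s) s) t (fx (g t) t * dg + ft).
Proof.
intros Hloc Hc Hft Hg.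
pose proof (proj1 (continuity_2d_pt_filterlim _ _ _) Hc) as Hc'.
pose proof (is_derive_filterdiff f (g t) t fx ft Hloc Hft Hc') as HD.
unfold is_derive.
eapply filterdiff_ext_lin.
- apply (filterdiff_comp'_2 (K := R_AbsRing) (T := R_NormedModule)
    (U := R_NormedModule) (V := R_NormedModule) (W := R_NormedModule)
    g (fun s => s) f t (fun y => scal y dg) (fun y => y)
    (fun y z => plus (scal y (fx (g t) t)) (scal z ft))).
  + exact Hg.
  + apply filterdiff_id.
  + exact HD.
- intros y; unfold scal, plus; simpl; unfold mult; simpl; ring.
Qed.

Lemma ex_RInt_continuity (f : R -> R) (a b : R) :
  (forall x, continuity_pt f x) -> ex_RInt f a b.
Proof.
intros Hf; apply (ex_RInt_continuous f).
intros z _; apply continuity_pt_filterlim, Hf.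
Qed.

Lemma is_derive_RInt_continuity (f : R -> R) (a x : R) :
  (forall y, continuity_pt f y) -> is_derive (RInt f a) x (f x).
Proof.
intros Hf; apply (is_derive_RInt f (RInt f a) a x).
- apply filter_forall; intros y.
  now apply (RInt_correct f), ex_RInt_continuity.
- apply continuity_pt_filterlim, Hf.
Qed.

(** The integral over [0, x] is continuous in x, and uniform continuity on a
    compact box controls the change of the integrand with t. *)
Lemma continuity_2d_pt_RInt (f : R -> R -> R) :
  (forall x t, continuity_2d_pt f x t) ->
  forall x t, continuity_2d_pt (fun y s => RInt (fun z => f z s) 0 y) x t.
Proof.
intros Hf x0 t0 eps.
assert (Hf1 : forall s y, continuity_pt (fun z => f z s) y).
{ intros s y; apply (continuity_2d_pt_path f (fun z => z) (fun _ => s)).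
  - apply Hf.
  - apply continuity_pt_id.
  - apply continuity_pt_const; now intros u v. }
set (B := Rabs x0 + 1).
assert (HB : 0 < B) by (unfold B; pose proof (Rabs_pos x0); lra).
assert (He : 0 < eps / 2 / B).
{ apply Rdiv_lt_0_compat; [|exact HB]. pose proof (cond_pos eps); lra. }
destruct (uniform_continuity_2d_1d f (- B) B t0 (fun x _ => Hf x t0)
            (mkposreal _ He)) as [d1 Hd1]; simpl in Hd1.
assert (Hg : continuity_pt (RInt (fun z => f z t0) 0) x0).
{ eapply is_derive_continuity_pt.
  apply (is_derive_RInt_continuity (fun z => f z t0)), Hf1. }
assert (He2 : 0 < eps / 2) by (pose proof (cond_pos eps); lra).
destruct (proj1 (continuity_pt_locally _ _) Hg (mkposreal _ He2)) as [d2 Hd2]; simpl in Hd2.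
assert (Hd : 0 < Rmin 1 (Rmin d1 d2)).
{ apply Rmin_pos; [lra|]. apply Rmin_pos; apply cond_pos. }
exists (mkposreal _ Hd); simpl; intros x s Hx Hs.
assert (H1 : Rabs (x - x0) < 1) by (eapply Rlt_le_trans; [exact Hx|apply Rmin_l]).
assert (H2 : Rabs (x - x0) < d2).
{ eapply Rlt_le_trans; [exact Hx|].
  eapply Rle_trans; [apply Rmin_r|apply Rmin_r]. }
assert (H3 : Rabs (s - t0) < d1).
{ eapply Rlt_le_trans; [exact Hs|].
  eapply Rle_trans; [apply Rmin_r|apply Rmin_l]. }
assert (HxB : Rabs x <= B).
{ unfold B; replace x with (x0 + (x - x0)) by ring.
  eapply Rle_trans; [apply Rabs_triang|lra]. }
replace (RInt (fun z => f z s) 0 x - RInt (fun z => f z t0) 0 x0) with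
  (RInt (fun z => f z s - f z t0) 0 x +
   (RInt (fun z => f z t0) 0 x - RInt (fun z => f z t0) 0 x0)).
2:{ rewrite (RInt_minus (fun z => f z s) (fun z => f z t0))
      by (apply ex_RInt_continuity; intros; apply Hf1).
    unfold minus, plus, opp; simpl; ring. }
eapply Rle_lt_trans; [apply Rabs_triang|].
assert (Hb : Rabs (RInt (fun z => f z s - f z t0) 0 x) <= Rabs (x - 0) * (eps / 2 / B)).
{ apply (norm_RInt_le_const_abs (fun z => f z s - f z t0) 0 x).
  - intros z Hz; left.
    assert (HzB : - B <= z <= B).
    { pose proof (Rle_abs x). pose proof (Rle_abs (- x)).
      rewrite Rabs_Ropp in H0.
      unfold Rmin, Rmax in Hz; destruct (Rle_dec 0 x); lra. }
    apply Rabs_def2 in H3.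
    apply (Hd1 z t0 z s); try (pose proof (cond_pos d1); lra).
    rewrite Rminus_eq_0, Rabs_R0; apply cond_pos.
  - apply (RInt_correct (fun z => f z s - f z t0)).
    apply ex_RInt_continuity; intros y; apply continuity_pt_minus; apply Hf1. }
specialize (Hd2 x H2).
assert (Rabs (x - 0) * (eps / 2 / B) <= eps / 2).
{ rewrite Rminus_0_r. apply Rle_trans with (B * (eps / 2 / B)).
  - apply Rmult_le_compat_r; lra.
  - right; field; lra. }
lra.
Qed.

Lemma nonincreasing_of_derive (f df : R -> R) (a b : R) :
  a <= b ->
  (forall t, a <= t <= b -> continuity_pt f t) ->
  (forall t, a < t < b -> is_derive f t (df t) /\ df t <= 0) -> f b <= f a.
Proof.
intros Hab Hc Hd.
(* [MVT_gen] returns a point of the closed interval, where the sign of [df] is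
   unknown at the ends; the truncation agrees with [df] inside. *)
destruct (MVT_gen f a b (fun t => Rmin (df t) 0)) as [c [Hc1 Hc2]];
  rewrite ?Rmin_left, ?Rmax_right in * by lra.
- intros t Ht; destruct (Hd t Ht) as [H1 H2].
  now rewrite Rmin_left by exact H2.
- exact Hc.
- pose proof (Rmin_r (df c) 0). nra.
Qed.

Lemma nondecreasing_of_derive (f df : R -> R) (a b : R) :
  a <= b ->
  (forall t, a <= t <= b -> continuity_pt f t) ->
  (forall t, a < t < b -> is_derive f t (df t) /\ 0 <= df t) -> f a <= f b.
Proof.
intros Hab Hc Hd.
enough (- f b <= - f a) by lra.
apply (nonincreasing_of_derive (fun t => - f t) (fun t => - df t) a b Hab).
- intros t Ht; apply continuity_pt_opp, Hc, Ht.
- intros t Ht; destruct (Hd t Ht) as [H1 H2]; split; [|lra].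
  now apply (is_derive_opp f).
Qed.

Lemma increasing_of_derive (f df : R -> R) :
  (forall x, is_derive f x (df x)) -> (forall x, 0 < df x) ->
  forall x y, x < y -> f x < f y.
Proof.
intros Hd Hp x y Hxy.
destruct (MVT_gen f x y df) as [z [_ Hz]].
- intros; apply Hd.
- intros; eapply is_derive_continuity_pt, Hd.
- specialize (Hp z). nra.
Qed.

Lemma is_derive_constant (f : R -> R) :
  (forall t, is_derive f t 0) -> forall t, f t = f 0.
Proof.
intros Hf t; destruct (MVT_gen f 0 t (fun _ => 0)) as [x [_ Hx]].
- intros; apply Hf.
- intros; eapply is_derive_continuity_pt, Hf.
- lra.
Qed.

Lemma antiderivative_0 (f : R -> R) :
  continuity f -> exists I : R -> R, I 0 = 0 /\ forall t, is_derive I t (f t).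
Proof.
intros Hf; exists (RInt f 0); split; [exact (RInt_point 0 f)|].
intros t; now apply is_derive_RInt_continuity.
Qed.

Lemma locally_open_interval a b t : a < t < b -> locally t (fun s => a < s < b).
Proof. intros [H1 H2]; now apply (locally_interval _ t a b). Qed.

Lemma continuity_pt_slice_x (f : R -> R -> R) x t :
  (forall x t, continuity_2d_pt f x t) -> continuity_pt (fun y => f y t) x.
Proof.
intros Hf; apply (continuity_2d_pt_path f (fun y => y) (fun _ => t)).
- apply Hf.
- apply continuity_pt_id.
- const_pt.
Qed.

Lemma continuity_pt_slice_t (f : R -> R -> R) x t :
  (forall x t, continuity_2d_pt f x t) -> continuity_pt (f x) t.
Proof.
intros Hf; apply (continuity_2d_pt_path f (fun _ => x) (fun s => s)).
- apply Hf.
- const_pt.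
- apply continuity_pt_id.
Qed.

Lemma locally_2d_pos (g : R -> R -> R) x t :
  continuity_2d_pt g x t -> 0 < g x t -> locally_2d (fun y s => 0 < g y s) x t.
Proof.
intros Hg Hp; destruct (Hg (mkposreal _ Hp)) as [del Hdel].
exists del; intros y s Hy Hs; specialize (Hdel y s Hy Hs); simpl in Hdel.
apply Rabs_def2 in Hdel; lra.
Qed.

(** Gronwall: the squared norm z^2 + e^2 grows at rate at most 4 K, so that its
    product with exp (- 4 K t) is nonincreasing from the value 0. *)
Lemma linear_system_zero (z e dz de : R -> R) (K T : R) :
  0 <= K ->
  (forall t, 0 <= t <= T -> continuity_pt z t /\ continuity_pt e t) ->
  (forall t, 0 < t < T -> is_derive z t (dz t) /\ is_derive e t (de t)) ->
  (forall t, 0 < t < T -> Rabs (dz t) <= K * (Rabs (z t) + Rabs (e t)) /\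
                          Rabs (de t) <= K * (Rabs (z t) + Rabs (e t))) ->
  z 0 = 0 -> e 0 = 0 ->
  forall t, 0 <= t <= T -> z t = 0 /\ e t = 0.
Proof.
intros HK Hc Hd Hb Hz0 He0 t Ht.
set (W := fun s => (z s ^ 2 + e s ^ 2) * exp (- (4 * K) * s)).
assert (HW : W t <= W 0).
{ apply (nonincreasing_of_derive W
    (fun s => (2 * z s * dz s + 2 * e s * de s - 4 * K * (z s ^ 2 + e s ^ 2))
              * exp (- (4 * K) * s))); [lra| |].
  - intros s Hs; destruct (Hc s ltac:(lra)) as [H1 H2].
    assert (H3 : continuity_pt (fun s => exp (- (4 * K) * s)) s).
    { apply is_derive_continuity_pt with (l := - (4 * K) * exp (- (4 * K) * s)).
      auto_derive; [easy|ring]. }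
    unfold W; simpl.
    repeat first [apply continuity_pt_mult | apply continuity_pt_plus
                 | assumption | apply continuity_pt_const; now intros ? ?].
  - intros s Hs; split.
    + destruct (Hd s ltac:(lra)) as [H1 H2]; unfold W.
      auto_derive.
      * repeat split; [now exists (dz s)|now exists (de s)].
      * rewrite (is_derive_unique (fun r : R => z r) _ _ H1), (is_derive_unique (fun r : R => e r) _ _ H2).
        simpl; ring.
    + destruct (Hb s ltac:(lra)) as [H1 H2].
      apply Rmult_le_0_r; [|left; apply exp_pos].
      assert (Hm : z s * dz s + e s * de s
              <= Rabs (z s) * Rabs (dz s) + Rabs (e s) * Rabs (de s)).
      { rewrite <- !Rabs_mult; apply Rplus_le_compat; apply Rle_abs. }
      assert (Hz : z s ^ 2 = Rabs (z s) ^ 2) by (rewrite RPow_abs, Rabs_pos_eq; [easy|apply pow2_ge_0]).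
      assert (He : e s ^ 2 = Rabs (e s) ^ 2) by (rewrite RPow_abs, Rabs_pos_eq; [easy|apply pow2_ge_0]).
      rewrite Hz, He.
      pose proof (Rabs_pos (z s)) as Pz; pose proof (Rabs_pos (e s)) as Pe.
      set (p := Rabs (z s)) in *; set (q := Rabs (e s)) in *.
      assert (p * Rabs (dz s) <= p * (K * (p + q))) by now apply Rmult_le_compat_l.
      assert (q * Rabs (de s) <= q * (K * (p + q))) by now apply Rmult_le_compat_l.
      assert (0 <= K * (p - q) ^ 2) by (apply Rmult_le_pos; [easy|apply pow2_ge_0]).
      nra. }
unfold W in HW; rewrite Hz0, He0 in HW.
pose proof (exp_pos (- (4 * K) * t)).
assert (z t ^ 2 + e t ^ 2 <= 0).
{ apply Rmult_le_reg_r with (exp (- (4 * K) * t)); [easy|].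
  eapply Rle_trans; [exact HW|]. simpl; lra. }
split; nra.
Qed.

Lemma positive_of_nonzero (f : R -> R) (T : R) :
  continuity f -> 0 < f 0 -> (forall t, 0 <= t <= T -> f t <> 0) ->
  forall t, 0 <= t <= T -> 0 < f t.
Proof.
intros Hc H0 Hn t Ht.
destruct (Rlt_le_dec 0 (f t)) as [H|H]; [exact H|exfalso].
destruct (IVT_gen f 0 t 0 Hc) as [s [Hs1 Hs2]].
- rewrite Rmin_right, Rmax_left by lra; lra.
- rewrite Rmin_left, Rmax_right in Hs1 by lra.
  apply (Hn s); [lra|exact Hs2].
Qed.

(** For a primitive g of f, the integral over [a, b] is g b - g a; that it tends
    to 0 is a Cauchy condition at each end together with equality of the two
    limits.  This turns neutrality into a statement on the electric field. *)
Lemma is_RInt_line_iff (g f : R -> R) :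
  (forall x, is_derive g x (f x)) -> (forall x, continuity_pt f x) ->
  is_RInt_line f 0 <->
  exists l : R, is_lim g m_infty l /\ is_lim g p_infty l.
Proof.
intros Hd Hc.
assert (HI : forall a b, is_RInt f a b (g b - g a)).
{ intros a b; apply (is_RInt_derive g f).
  - intros; apply Hd.
  - intros; apply continuity_pt_filterlim, Hc. }
split.
- intros H.
  assert (HG : forall eps : posreal, exists A B, forall a b, a < A -> B < b ->
                 Rabs (g b - g a) < eps).
  { intros eps. 
    destruct (proj1 (filterlimi_locally _ _) H eps) as [P Q [A HA] [B HB] HPQ].
    exists A, B; intros a b Ha Hb.
    destruct (HPQ a b (HA a Ha) (HB b Hb)) as [z [Hz1 Hz2]].
    simpl in Hz1.
    assert (Hz : z = g b - g a).
    { rewrite <- (is_RInt_unique _ _ _ _ Hz1).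
      now apply is_RInt_unique. }
    subst z; unfold ball in Hz2; simpl in Hz2; unfold AbsRing_ball in Hz2.
    unfold abs, minus, plus, opp in Hz2; simpl in Hz2.
    replace (g b - g a) with (g b - g a + - 0) by ring. exact Hz2. }
  assert (Hcauchy : exists l, filterlim g (Rbar_locally p_infty) (locally l)).
  { apply (proj1 (filterlim_locally_cauchy (U := R_CompleteSpace) g)); intros eps.
    destruct (HG (pos_div_2 eps)) as [A [B HAB]].
    exists (fun b => B < b); split; [now exists B|].
    intros u v Hu Hv; unfold ball; simpl; unfold AbsRing_ball, abs, minus, plus, opp; simpl.
    pose proof (HAB (A - 1) u ltac:(lra) Hu) as H1.
    pose proof (HAB (A - 1) v ltac:(lra) Hv) as H2.
    simpl in H1, H2. apply Rabs_def2 in H1; apply Rabs_def2 in H2.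
    apply Rabs_def1; lra. }
  destruct Hcauchy as [l Hl]; exists l.
  assert (Hl' : is_lim g p_infty l) by exact Hl.
  split; [|exact Hl'].
  apply is_lim_spec; intros eps.
  apply is_lim_spec in Hl'.
  destruct (Hl' (pos_div_2 eps)) as [B1 HB1].
  destruct (HG (pos_div_2 eps)) as [A [B HAB]].
  exists A; intros x Hx.
  pose proof (HB1 (Rmax B B1 + 1)) as H1.
  pose proof (Rmax_l B B1); pose proof (Rmax_r B B1).
  specialize (H1 ltac:(lra)).
  pose proof (HAB x (Rmax B B1 + 1) Hx ltac:(lra)) as H3.
  simpl in H1, H3. apply Rabs_def2 in H1; apply Rabs_def2 in H3.
  apply Rabs_def1; lra.
- intros [l [Hm Hp]].
  apply filterlimi_locally; intros eps.
  apply is_lim_spec in Hm; apply is_lim_spec in Hp.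
  destruct (Hm (pos_div_2 eps)) as [A HA], (Hp (pos_div_2 eps)) as [B HB].
  apply (Filter_prod _ _ _ (fun x => x < A) (fun x => B < x));
    [now exists A|now exists B|].
  intros a b Ha Hb; exists (g b - g a); split; [apply HI|].
  unfold ball; simpl; unfold AbsRing_ball, abs, minus, plus, opp; simpl.
  specialize (HA a Ha); specialize (HB b Hb); simpl in HA, HB.
  apply Rabs_def2 in HA; apply Rabs_def2 in HB.
  apply Rabs_def1; lra.
Qed.

(** * Damped oscillations *)

(** y1 and y2 solve y'' + nu y' + k c y = 0 with initial data (1, 0) and (0, 1),
    written as a first-order system; only this system is used until the
    collapse criteria, where the three regimes are made explicit. *)
Record fundamental (k c nu : R) (y1 y2 : R -> R) : Prop := {
  fund_y1_0 : y1 0 = 1;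
  fund_y2_0 : y2 0 = 0;
  fund_dy1 : forall t, is_derive y1 t (- (k * c) * y2 t);
  fund_dy2 : forall t, is_derive y2 t (y1 t - nu * y2 t)
}.

(** The solution of w'' + nu w' + k c w = k r with w (0) = 1 and w' (0) = d: the
    derivative with respect to the label of the position along a
    characteristic, when r and d are the initial density and velocity gradient
    at that label. *)
Definition jacobian (c : R) (y1 y2 : R -> R) (r d t : R) : R :=
  1 + (r - c) * ((1 - y1 t) / c) + d * y2 t.

Definition collapses (c : R) (y1 y2 : R -> R) (r d : R) : Prop :=
  exists t, 0 <= t /\ jacobian c y1 y2 r d t <= 0.

Lemma is_derive_jacobian k c nu y1 y2 r d t :
  0 < c -> fundamental k c nu y1 y2 ->
  is_derive (jacobian c y1 y2 r d) t
    (d * y1 t - (nu * d + k * (c - r)) * y2 t).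
Proof.
intros Hc [_ _ H1 H2]; unfold jacobian; specialize (H1 t); specialize (H2 t).
auto_derive.
- repeat split; eexists; eassumption.
- rewrite (is_derive_unique (fun x : R => y1 x) _ _ H1),
          (is_derive_unique (fun x : R => y2 x) _ _ H2).
  field; lra.
Qed.

Lemma fundamental_continuity k c nu y1 y2 :
  fundamental k c nu y1 y2 -> continuity y1 /\ continuity y2.
Proof.
intros [_ _ H1 H2]; split; intros t; eapply is_derive_continuity_pt; auto.
Qed.

(** Abel's identity for the Wronskian y1 y2' - y1' y2. *)
Lemma fundamental_wronskian k c nu y1 y2 :
  fundamental k c nu y1 y2 ->
  forall t, y1 t * (y1 t - nu * y2 t) + k * c * y2 t ^ 2 = exp (- nu * t).
Proof.
intros [H10 H20 H1 H2] t.
set (D := fun t => (y1 t * (y1 t - nu * y2 t) + k * c * y2 t ^ 2) * exp (nu * t)).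
assert (HD : D t = D 0).
{ apply is_derive_constant; intros x; specialize (H1 x); specialize (H2 x).
  unfold D; auto_derive; [repeat split; eexists; eassumption|].
  rewrite (is_derive_unique (fun x : R => y1 x) _ _ H1),
          (is_derive_unique (fun x : R => y2 x) _ _ H2); ring. }
unfold D in HD; rewrite H10, H20, Rmult_0_r, exp_0 in HD.
apply Rmult_eq_reg_r with (exp (nu * t)); [|apply Rgt_not_eq, exp_pos].
rewrite HD, <- exp_plus; replace (- nu * t + nu * t) with 0 by ring.
rewrite exp_0; ring.
Qed.

(** Variation of constants; the weight exp (nu s) is the inverse of the
    Wronskian. *)
Lemma forced_oscillation k c nu y1 y2 (F : R -> R) :
  fundamental k c nu y1 y2 -> continuity F ->
  exists p q : R -> R, p 0 = 0 /\ q 0 = 0 /\ forall t,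
    is_derive p t (q t) /\
    is_derive q t (- nu * q t - k * c * p t + k * F t).
Proof.
intros HF HcF.
pose proof (fundamental_wronskian _ _ _ _ _ HF) as HW.
destruct (fundamental_continuity _ _ _ _ _ HF) as [Hc1 Hc2].
destruct HF as [H10 H20 H1 H2].
set (f1 := fun s => y2 s * (k * F s * exp (nu * s))).
set (f2 := fun s => y1 s * (k * F s * exp (nu * s))).
assert (Hexp : continuity (fun s => exp (nu * s))).
{ intros s; apply is_derive_continuity_pt with (nu * exp (nu * s)).
  auto_derive; [easy|ring]. }
destruct (antiderivative_0 f1) as [I1 [HI10 HI1]].
{ intros s; unfold f1.
  repeat first [apply continuity_pt_mult | apply Hc2 | apply HcF | apply Hexp | const_pt]. }
destruct (antiderivative_0 f2) as [I2 [HI20 HI2]].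
{ intros s; unfold f2.
  repeat first [apply continuity_pt_mult | apply Hc1 | apply HcF | apply Hexp | const_pt]. }
exists (fun t => - y1 t * I1 t + y2 t * I2 t),
       (fun t => k * c * y2 t * I1 t + (y1 t - nu * y2 t) * I2 t).
rewrite HI10, HI20; (split; [ring|split; [ring|intros t; split]]).
- specialize (H1 t); specialize (H2 t); specialize (HI1 t); specialize (HI2 t).
  auto_derive; [repeat split; eexists; eassumption|].
  rewrite (is_derive_unique (fun x : R => y1 x) _ _ H1),
          (is_derive_unique (fun x : R => y2 x) _ _ H2),
          (is_derive_unique (fun x : R => I1 x) _ _ HI1),
          (is_derive_unique (fun x : R => I2 x) _ _ HI2).
  unfold f1, f2; ring.
- specialize (H1 t); specialize (H2 t); specialize (HI1 t); specialize (HI2 t).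
  auto_derive; [repeat split; eexists; eassumption|].
  rewrite (is_derive_unique (fun x : R => y1 x) _ _ H1),
          (is_derive_unique (fun x : R => y2 x) _ _ H2),
          (is_derive_unique (fun x : R => I1 x) _ _ HI1),
          (is_derive_unique (fun x : R => I2 x) _ _ HI2).
  assert (HWt : (y1 t * (y1 t - nu * y2 t) + k * c * y2 t ^ 2) * exp (nu * t) = 1).
  { rewrite HW, <- exp_plus, <- exp_0; f_equal; ring. }
  unfold f1, f2; apply Rminus_diag_uniq.
  transitivity (k * F t *
    ((y1 t * (y1 t - nu * y2 t) + k * c * y2 t ^ 2) * exp (nu * t) - 1));
    [ring|rewrite HWt; ring].
Qed.

Lemma fundamental_y2_pos k c nu y1 y2 :
  fundamental k c nu y1 y2 ->
  exists del, 0 < del /\ forall t, 0 < t < del -> 0 < y2 t.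
Proof.
intros HF; destruct (fundamental_continuity _ _ _ _ _ HF) as [Hc1 Hc2].
destruct HF as [H10 H20 _ H2].
assert (Hc : continuity_pt (fun t => y1 t - nu * y2 t) 0).
{ apply continuity_pt_minus; [apply Hc1|].
  apply continuity_pt_mult; [const_pt|apply Hc2]. }
destruct (proj1 (continuity_pt_locally _ _) Hc (mkposreal 1 Rlt_0_1)) as [del Hdel].
simpl in Hdel; rewrite H10, H20 in Hdel.
exists del; split; [apply cond_pos|]; intros t Ht.
destruct (MVT_gen y2 0 t (fun t => y1 t - nu * y2 t)) as [s [Hs1 Hs2]].
- intros; apply H2.
- intros; apply Hc2.
- rewrite Rmin_left, Rmax_right in Hs1 by lra.
  rewrite H20 in Hs2.
  assert (Hb : Rabs (y1 s - nu * y2 s - (1 - nu * 0)) < 1).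
  { apply Hdel; unfold ball; simpl; unfold AbsRing_ball, abs, minus, plus, opp; simpl.
    apply Rabs_def1; lra. }
  apply Rabs_def2 in Hb. nra.
Qed.

(** The energy of the oscillation about the rest value r / c has derivative
    - 2 nu w'^2. *)
Lemma fundamental_energy k c nu y1 y2 r d s t :
  0 < k -> 0 < c -> 0 < nu -> fundamental k c nu y1 y2 -> s <= t ->
  let v := fun t => d * y1 t - (nu * d + k * (c - r)) * y2 t in
  let w := fun t => jacobian c y1 y2 r d t - r / c in
  v t ^ 2 + k * c * w t ^ 2 <= v s ^ 2 + k * c * w s ^ 2.
Proof.
intros hk hc hnu HF Hst v w.
set (E := fun t => v t ^ 2 + k * c * w t ^ 2).
assert (Hw : forall t, is_derive w t (v t)).
{ intros x; unfold w; apply (is_derive_eq _ _ (v x - 0)); [|ring].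
  apply (is_derive_minus (jacobian c y1 y2 r d) (fun _ => r / c)).
  - now apply (is_derive_jacobian k c nu).
  - apply (is_derive_const (V := R_NormedModule)). }
assert (Hv : forall t, is_derive v t (- nu * v t - k * c * w t)).
{ intros x; destruct HF as [_ _ H1 H2]; specialize (H1 x); specialize (H2 x).
  unfold v; auto_derive; [repeat split; eexists; eassumption|].
  rewrite (is_derive_unique (fun x : R => y1 x) _ _ H1),
          (is_derive_unique (fun x : R => y2 x) _ _ H2).
  unfold w, jacobian; field; lra. }
assert (HE : forall t, is_derive E t (- (2 * nu) * v t ^ 2)).
{ intros x; specialize (Hw x); specialize (Hv x).
  unfold E; auto_derive; [repeat split; eexists; eassumption|].
  rewrite (is_derive_unique (fun x : R => v x) _ _ Hv),
          (is_derive_unique (fun x : R => w x) _ _ Hw).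
  ring. }
apply (nonincreasing_of_derive E (fun t => - (2 * nu) * v t ^ 2) s t Hst).
- intros x _; eapply is_derive_continuity_pt, HE.
- intros x _; split; [apply HE|].
  pose proof (pow2_ge_0 (v x)). nra.
Qed.

(** * When the Jacobian vanishes *)

Lemma exp_le_compat x y : x <= y -> exp x <= exp y.
Proof. intros [H| ->]; [left; now apply exp_increasing|apply Rle_refl]. Qed.

Lemma exp_ge_tangent x a : exp a * (1 + (x - a)) <= exp x.
Proof.
replace x with (a + (x - a)) at 2 by ring; rewrite exp_plus.
apply Rmult_le_compat_l; [left; apply exp_pos|].
apply exp_ineq1_le.
Qed.

(** Convexity between 0 and x: the tangent at th x lies below the graph at both
    ends. *)
Lemma exp_weighted_mean th x : 0 <= th <= 1 -> exp (th * x) <= 1 - th + th * exp x.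
Proof.
intros Hth.
pose proof (exp_ge_tangent x (th * x)) as H1.
pose proof (exp_ge_tangent 0 (th * x)) as H0; rewrite exp_0 in H0.
apply Rmult_le_compat_l with (r := th) in H1; [|lra].
apply Rmult_le_compat_l with (r := 1 - th) in H0; [|lra].
nra.
Qed.

Lemma Rmax_lt_0 a b : Rmax a b < 0 <-> a < 0 /\ b < 0.
Proof.
split.
- intros H; pose proof (Rmax_l a b); pose proof (Rmax_r a b); lra.
- intros [H1 H2]; now apply Rmax_lub_lt.
Qed.

(** Real distinct roots - c l1 and - c l2; k and nu are recovered as c l1 l2 and
    c (l1 + l2). *)
Section Overdamped.
Variables c l1 l2 : R.
Hypotheses (hc : 0 < c) (hl1 : 0 < l1) (hl12 : l1 < l2).

Let e1 t := exp (- (c * l1) * t).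
Let e2 t := exp (- (c * l2) * t).

Lemma overdamped_fundamental :
  fundamental (c * l1 * l2) c (c * (l1 + l2))
    (fun t => (l2 * e1 t - l1 * e2 t) / (l2 - l1))
    (fun t => (e1 t - e2 t) / (c * (l2 - l1))).
Proof.
split; unfold e1, e2.
- rewrite !Rmult_0_r, exp_0; field; lra.
- rewrite !Rmult_0_r, exp_0; field; lra.
- intros t; auto_derive; [easy|]. field; lra.
- intros t; auto_derive; [easy|]. field; lra.
Qed.

Lemma overdamped_exp_ratio s t : 0 <= s <= t -> e1 s * e2 t <= e1 t * e2 s.
Proof.
intros Hs; unfold e1, e2; rewrite <- !exp_plus; apply exp_le_compat.
assert (0 <= c * ((l2 - l1) * (t - s))).
{ apply Rmult_le_pos; [lra|apply Rmult_le_pos; lra]. }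
lra.
Qed.

(** Up to a positive factor the Jacobian is l2 - l1 - (l2 p - l1 q) with
    p = P e1 and q = Q e2, and its time derivative is p - q up to a positive
    factor.  Since e1 ^ l2 = e2 ^ l1, the quotient p ^ l2 / q ^ l1 does not
    depend on time, and the inequality l2 p >= l2 - l1 + l1 q forces
    p >= q ^ (l1 / l2) by weighted means; hence the condition on P and Q.
    Conversely the critical time, where p = q, is a minimum of the Jacobian, of
    the sign of 1 - p. *)
Lemma overdamped_collapse P Q :
  l2 * P - l1 * Q < l2 - l1 ->
  (exists t, 0 <= t /\ l2 - l1 <= l2 * (P * e1 t) - l1 * (Q * e2 t)) <->
  0 < P /\ P < Q /\ Rpower Q l1 <= Rpower P l2.
Proof.
intros H0; set (f := fun t => l2 * (P * e1 t) - l1 * (Q * e2 t)).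
assert (Hf : forall t, is_derive f t (- (c * l1 * l2) * (P * e1 t - Q * e2 t))).
{ intros t; unfold f, e1, e2; auto_derive; [easy|ring]. }
assert (E1 : forall t, 0 < e1 t) by (intros; apply exp_pos).
assert (E2 : forall t, 0 < e2 t) by (intros; apply exp_pos).
assert (Hk : 0 < c * l1 * l2).
{ apply Rmult_lt_0_compat; [apply Rmult_lt_0_compat|]; lra. }
split.
- intros [t [Ht Hft]].
  (* as long as p >= q the Jacobian does not decrease from its positive initial value *)
  assert (Hdec : (forall s, 0 <= s <= t -> Q * e2 s <= P * e1 s) -> False).
  { intros Hs.
    assert (f t <= f 0).
    { apply (nonincreasing_of_derive f
        (fun t => - (c * l1 * l2) * (P * e1 t - Q * e2 t))); [exact Ht| |].
      - intros s _; eapply is_derive_continuity_pt, Hf.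
      - intros s Hs'; split; [apply Hf|].
        specialize (Hs s ltac:(lra)). nra. }
    unfold f, e1 at 2, e2 at 2 in H; rewrite !Rmult_0_r, exp_0 in H; lra. }
  destruct (Rle_lt_dec P 0) as [HP|HP].
  { exfalso; destruct (Rle_lt_dec (P * e1 t) (Q * e2 t)) as [H|H].
    - assert (Hp : P * e1 t <= 0) by (specialize (E1 t); nra).
      apply Rmult_le_compat_l with (r := l1) in H; [|lra].
      apply Rmult_le_compat_l with (r := l2 - l1) in Hp; lra.
    - apply Hdec; intros s Hs.
      apply Rmult_le_reg_r with (e2 t); [apply E2|].
      pose proof (overdamped_exp_ratio s t Hs) as H1.
      apply Rmult_le_compat_neg_l with (r := P) in H1; [|exact HP].
      apply Rmult_lt_compat_r with (r := e2 s) in H; [|apply E2].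
      lra. }
  destruct (Rle_lt_dec Q P) as [HQ|HQ].
  { exfalso; apply Hdec; intros s Hs.
    pose proof (overdamped_exp_ratio 0 s ltac:(lra)) as H.
    unfold e1 at 1, e2 at 2 in H; rewrite !Rmult_0_r, exp_0 in H.
    specialize (E1 s); specialize (E2 s). nra. }
  split; [exact HP|split; [exact HQ|]].
  assert (Hp : 0 < P * e1 t) by (apply Rmult_lt_0_compat; auto).
  assert (Hq : 0 < Q * e2 t) by (apply Rmult_lt_0_compat; [lra|auto]).
  (* weighted mean of 1 and q, with weights 1 - l1 / l2 and l1 / l2 *)
  pose proof (exp_weighted_mean (l1 / l2) (ln (Q * e2 t))) as HW.
  rewrite exp_ln in HW by exact Hq.
  assert (Hth : 0 <= l1 / l2 <= 1).
  { split; [left; apply Rdiv_lt_0_compat; lra|].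
    apply Rmult_le_reg_r with l2; [lra|]; unfold Rdiv.
    rewrite Rmult_assoc, Rinv_l; lra. }
  specialize (HW Hth).
  assert (HP' : exp (l1 / l2 * ln (Q * e2 t)) <= P * e1 t).
  { eapply Rle_trans; [exact HW|].
    apply Rmult_le_reg_l with l2; [lra|].
    replace (l2 * (1 - l1 / l2 + l1 / l2 * (Q * e2 t)))
      with (l2 - l1 + l1 * (Q * e2 t)) by (field; lra).
    lra. }
  unfold Rpower; apply exp_le_compat.
  apply ln_le in HP'; [|apply exp_pos]; rewrite ln_exp in HP'.
  rewrite !ln_mult in HP' by (auto; lra).
  unfold e1, e2 in HP'; rewrite !ln_exp in HP'.
  apply Rmult_le_compat_l with (r := l2) in HP'; [|lra].
  replace (l2 * (l1 / l2 * (ln Q + - (c * l2) * t)))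
    with (l1 * (ln Q + - (c * l2) * t)) in HP' by (field; lra).
  nra.
- intros [HP [HQ HR]].
  (* the time at which P e1 = Q e2 *)
  set (t := (ln Q - ln P) / (c * (l2 - l1))).
  assert (Hcl : 0 < c * (l2 - l1)) by (apply Rmult_lt_0_compat; lra).
  assert (Hln : 0 < ln Q - ln P) by (pose proof (ln_increasing P Q HP HQ); lra).
  assert (Hct : c * t * (l2 - l1) = ln Q - ln P) by (unfold t; field; lra).
  exists t; split; [left; apply Rdiv_lt_0_compat; assumption|].
  assert (HPe : P * e1 t = Q * e2 t).
  { unfold e1, e2.
    rewrite <- (exp_ln P HP) at 1; rewrite <- (exp_ln Q) at 1 by lra.
    rewrite <- !exp_plus; f_equal; nra. }
  rewrite <- HPe.
  assert (1 <= P * e1 t).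
  { unfold e1; rewrite <- (exp_ln P HP), <- exp_plus.
    rewrite <- exp_0; apply exp_le_compat.
    unfold Rpower in HR.
    assert (HR' : l1 * ln Q <= l2 * ln P).
    { destruct (Rle_lt_dec (l1 * ln Q) (l2 * ln P)) as [H|H]; [exact H|].
      apply exp_increasing in H; lra. }
    apply Rmult_le_reg_r with (l2 - l1); [lra|].
    replace ((ln P + - (c * l1) * t) * (l2 - l1)) with
      (ln P * (l2 - l1) - l1 * (c * t * (l2 - l1))) by ring.
    rewrite Hct; lra. }
  nra.
Qed.

End Overdamped.

(** The two quotients of the condition are - P and - Q for the amplitudes P and
    Q of the slow and the fast exponential in the Jacobian.  Moreover d has the
    sign of P - Q, and d + lambda2 (c - r) that of - P. *)
Lemma strong_damping_collapse k c nu :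
  0 < k -> 0 < c -> 0 < nu -> 2 * sqrt (k * c) < nu ->
  exists y1 y2, fundamental k c nu y1 y2 /\
    forall r d, 0 < r ->
      collapses c y1 y2 r d <-> strong_damping_condition k c nu r d.
Proof.
intros hk hc hnu hs.
assert (hkc : 0 < k * c) by (apply Rmult_lt_0_compat; lra).
pose proof (sqrt_lt_R0 _ hkc) as Hsq.
pose proof (sqrt_sqrt _ (Rlt_le _ _ hkc)) as Hsq2.
assert (hD : 0 < nu ^ 2 - 4 * k * c) by nra.
pose proof (sqrt_lt_R0 _ hD) as HD1.
pose proof (sqrt_sqrt _ (Rlt_le _ _ hD)) as HD2.
unfold strong_damping_condition.
set (l1 := lambda1 k c nu); set (l2 := lambda2 k c nu).
assert (Hlt : sqrt (nu ^ 2 - 4 * k * c) < nu) by nra.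
assert (Hl1 : 0 < l1) by (unfold l1, lambda1; apply Rdiv_lt_0_compat; lra).
assert (Hl12 : l1 < l2).
{ unfold l1, l2, lambda1, lambda2; apply Rmult_lt_compat_r; [|lra].
  apply Rinv_0_lt_compat; lra. }
assert (Hsum : c * (l1 + l2) = nu) by (unfold l1, l2, lambda1, lambda2; field; lra).
assert (Hprod : c * l1 * l2 = k).
{ unfold l1, l2, lambda1, lambda2.
  set (s := sqrt (nu ^ 2 - 4 * k * c)) in *.
  replace (c * ((nu - s) / (2 * c)) * ((nu + s) / (2 * c)))
    with ((nu ^ 2 - s * s) / (4 * c)) by (field; lra).
  rewrite HD2; field; lra. }
clearbody l1 l2; clear - hk hc hnu Hl1 Hl12 Hsum Hprod.
pose proof (overdamped_fundamental c l1 l2 hc Hl12) as HF.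
rewrite Hprod, Hsum in HF.
do 2 eexists; split; [exact HF|]; intros r d hr.
set (P := - (d + l2 * (c - r)) / (l2 * r)).
set (Q := - (d + l1 * (c - r)) / (l1 * r)).
assert (HPQ : d = k * r / (c * (l2 - l1)) * (P - Q)).
{ unfold P, Q; rewrite <- Hprod; field; lra. }
assert (HJ : forall t, jacobian c
     (fun t => (l2 * exp (- (c * l1) * t) - l1 * exp (- (c * l2) * t)) / (l2 - l1))
     (fun t => (exp (- (c * l1) * t) - exp (- (c * l2) * t)) / (c * (l2 - l1))) r d t
   = r / (c * (l2 - l1)) * ((l2 - l1) -
       (l2 * (P * exp (- (c * l1) * t)) - l1 * (Q * exp (- (c * l2) * t))))).
{ intros t; unfold jacobian, P, Q; field; lra. }
assert (Hr : 0 < r / (c * (l2 - l1))).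
{ apply Rdiv_lt_0_compat; [lra|apply Rmult_lt_0_compat; lra]. }
assert (H0 : l2 * P - l1 * Q < l2 - l1).
{ replace (l2 * P - l1 * Q) with (l2 - l1 - c * (l2 - l1) / r)
    by (unfold P, Q; field; lra).
  assert (0 < c * (l2 - l1) / r); [|lra].
  apply Rdiv_lt_0_compat; [apply Rmult_lt_0_compat|]; lra. }
pose proof (overdamped_collapse c l1 l2 hc Hl1 Hl12 P Q H0) as HC.
assert (Hd : d < 0 <-> P < Q).
{ assert (Hkr : 0 < k * r / (c * (l2 - l1))).
  { replace (k * r / (c * (l2 - l1))) with (k * (r / (c * (l2 - l1))))
      by (field; lra). now apply Rmult_lt_0_compat. }
  split; intros H; [|nra].
  destruct (Rlt_le_dec P Q) as [H'|H']; [exact H'|nra]. }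
assert (Hp : d + l2 * (c - r) < 0 <-> 0 < P).
{ assert (Hlr : 0 < l2 * r) by (apply Rmult_lt_0_compat; lra).
  assert (HPe : P * (l2 * r) = - (d + l2 * (c - r))) by (unfold P; field; lra).
  split; intros H; nra. }
assert (HA1 : (c * l2 * d + k * (c - r)) / (k * r) = - Q).
{ unfold Q; rewrite <- Hprod; field; lra. }
assert (HA2 : (c * l1 * d + k * (c - r)) / (k * r) = - P).
{ unfold P; rewrite <- Hprod; field; lra. }
rewrite HA1, HA2, !Rabs_Ropp, Rmax_lt_0, Hd, Hp.
unfold collapses.
transitivity (0 < P /\ P < Q /\ Rpower Q l1 <= Rpower P l2).
- rewrite <- HC; split; intros [t [Ht H]]; exists t; split; try exact Ht.
  + rewrite HJ in H. nra.
  + rewrite HJ. nra.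
- split.
  + intros [H1 [H2 H3]]; rewrite !Rabs_pos_eq by lra; tauto.
  + intros [[H1 H2] H3]; rewrite !Rabs_pos_eq in H3 by lra; tauto.
Qed.

(** With m = nu / 2 the Jacobian is r / c + (al + ga t) exp (- m t).  Its only
    critical time is d / (m ga), and comparing exp (m t) with its tangent at
    that time gives the necessary inequality from any zero, without locating
    the minimum. *)
Lemma borderline_damping_collapse k c nu :
  0 < k -> 0 < c -> 0 < nu -> nu = 2 * sqrt (k * c) ->
  exists y1 y2, fundamental k c nu y1 y2 /\
    forall r d, 0 < r ->
      collapses c y1 y2 r d <-> borderline_damping_condition c nu r d.
Proof.
intros hk hc hnu hs.
assert (hkc : 0 < k * c) by (apply Rmult_lt_0_compat; lra).
pose proof (sqrt_sqrt _ (Rlt_le _ _ hkc)) as Hm2.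
set (m := nu / 2).
assert (Hnu : nu = 2 * m) by (unfold m; field).
assert (Hm : 0 < m) by lra.
replace (sqrt (k * c)) with m in Hm2 by lra.
clearbody m; clear hs; subst nu.
exists (fun t => (1 + m * t) * exp (- m * t)), (fun t => t * exp (- m * t)).
split.
{ split.
  - rewrite Rmult_0_r, Rmult_0_r, exp_0; ring.
  - ring.
  - intros t; auto_derive; [easy|]. rewrite <- Hm2; ring.
  - intros t; auto_derive; [easy|]. ring. }
intros r d hr.
set (al := (c - r) / c); set (ga := d + m * al).
assert (Hrc : 0 < r / c) by (apply Rdiv_lt_0_compat; lra).
assert (Hal : r / c = 1 - al) by (unfold al; field; lra).
assert (HJ : forall t, jacobian c (fun t => (1 + m * t) * exp (- m * t))
   (fun t => t * exp (- m * t)) r d t = r / c + (al + ga * t) * exp (- m * t)).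
{ intros t; unfold jacobian, ga, al; field; lra. }
unfold borderline_damping_condition, collapses.
replace (d + 2 * m / (2 * c) * (c - r)) with ga by (unfold ga, al; field; lra).
replace (2 * c * d + 2 * m * (c - r)) with (2 * c * ga)
  by (unfold ga, al; field; lra).
set (G := - ga / (m * (r / c))).
replace (- (2 * c * ga / (2 * m * r))) with G by (unfold G; field; lra).
assert (HG : m * (r / c) * G = - ga) by (unfold G; field; lra).
assert (HGp : ga < 0 -> 0 < G).
{ intros H; unfold G; apply Rdiv_lt_0_compat; [lra|].
  apply Rmult_lt_0_compat; lra. }
rewrite Rmax_lt_0; split.
- intros [t [Ht HJt]]; rewrite HJ in HJt.
  assert (Hmt : 0 <= m * t) by (apply Rmult_le_pos; lra).
  (* the same inequality after multiplication by exp (m t) *)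
  assert (HE : r / c * exp (m * t) <= - (al + ga * t)).
  { apply Rmult_le_reg_r with (exp (- m * t)); [apply exp_pos|].
    rewrite Rmult_assoc, <- exp_plus.
    replace (m * t + - m * t) with 0 by ring; rewrite exp_0; lra. }
  (* with exp (m t) >= 1 + m t this already excludes d >= 0 and ga >= 0 *)
  assert (H1 : 1 + m * t <= exp (m * t)) by apply exp_ineq1_le.
  assert (H2 : r / c * (1 + m * t) <= r / c * exp (m * t))
    by (apply Rmult_le_compat_l; lra).
  assert (Hd : d < 0).
  { destruct (Rlt_le_dec d 0) as [H|H]; [exact H|exfalso].
    assert (0 <= d * t) by (apply Rmult_le_pos; lra).
    rewrite Hal in H2, HE. unfold ga in HE. lra. }
  assert (Hga : ga < 0).
  { destruct (Rlt_le_dec ga 0) as [H|H]; [exact H|exfalso].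
    assert (0 <= ga * t) by (apply Rmult_le_pos; lra).
    assert (0 <= r / c * (m * t)) by (apply Rmult_le_pos; lra).
    lra. }
  repeat split; [exact Hd|exact Hga|].
  replace (2 * c * d / (2 * c * ga)) with (d / ga) by (field; lra).
  set (x := d / ga); assert (Hx : d = x * ga) by (unfold x; field; lra).
  apply Rle_ge; rewrite <- (ln_exp x); apply ln_le; [apply exp_pos|].
  pose proof (exp_ge_tangent (m * t) x) as HT.
  assert (Hid : m * (al + ga * t) = ga * (1 + (m * t - x))) by (unfold ga in *; lra).
  assert (HE2 : r / c * (exp x * (1 + (m * t - x))) <= G * (r / c) * (1 + (m * t - x))).
  { eapply Rle_trans; [apply Rmult_le_compat_l; [lra|exact HT]|].
    eapply Rle_trans; [exact HE|].
    apply Rmult_le_reg_l with m; [exact Hm|].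
    replace (m * (G * (r / c) * (1 + (m * t - x))))
      with (m * (r / c) * G * (1 + (m * t - x))) by ring.
    rewrite HG; lra. }
  assert (Hpos : 0 < 1 + (m * t - x)).
  { assert (0 < r / c * exp (m * t)) by (apply Rmult_lt_0_compat; [lra|apply exp_pos]).
    assert (0 < m * - (al + ga * t)) by (apply Rmult_lt_0_compat; lra).
    nra. }
  apply Rmult_le_reg_r with (r / c * (1 + (m * t - x))).
  + now apply Rmult_lt_0_compat.
  + lra.
- intros [[Hd Hga] HL].
  replace (2 * c * d / (2 * c * ga)) with (d / ga) in HL by (field; lra).
  (* the critical time *)
  set (t := d / ga / m).
  assert (Hx : 0 < d / ga).
  { replace (d / ga) with ((- d) / (- ga)) by (field; lra).
    apply Rdiv_lt_0_compat; lra. }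
  exists t; split; [left; now apply Rdiv_lt_0_compat|].
  rewrite HJ.
  replace (al + ga * t) with (- (r / c) * G)
    by (unfold t, G, ga in *; field; lra).
  replace (- m * t) with (- (d / ga)) by (unfold t; field; lra).
  assert (HGe : exp (d / ga) <= G).
  { rewrite <- (exp_ln G (HGp Hga)); apply exp_le_compat; lra. }
  assert (1 <= G * exp (- (d / ga))).
  { rewrite <- exp_0; replace 0 with (d / ga + - (d / ga)) by ring.
    rewrite exp_plus; apply Rmult_le_compat_r; [left; apply exp_pos|exact HGe]. }
  nra.
Qed.

(** The derivative of the Jacobian is exp (- nu t / 2) times
    d cos (m t) - q / (2 m) sin (m t).  The case distinction of [tstar] selects,
    among the zeros in one period, the one at which this trigonometric factor
    changes sign from negative to positive: it is C sin (m t - th) with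
    C >= 0. *)
Lemma tstar_phase k c nu r d :
  0 < mu k c nu -> 0 < nu ->
  let m := mu k c nu in
  let q := nu * d + 2 * k * (c - r) in
  let th := m * tstar k c nu r d in
  0 <= th <= 2 * PI /\
  exists C, 0 <= C /\ d = - C * sin th /\ q / (2 * m) = - C * cos th.
Proof.
intros Hm hnu m q th; unfold th, tstar; fold m; fold m in Hm.
pose proof PI_RGT_0 as Hpi.
destruct (Req_EM_T (nu * d) (2 * k * (r - c))) as [Hq|Hq].
- assert (Hq0 : q = 0) by (unfold q; lra).
  rewrite <- Rmult_assoc, Rinv_r, Rmult_1_l by lra.
  rewrite Hq0; destruct (Rlt_dec d 0) as [Hd|Hd]; (split; [lra|]).
  + exists (- d); rewrite sin_PI2, cos_PI2; (split; [lra|split; [lra|]]); unfold Rdiv; rewrite Rmult_0_l; ring.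
  + exists d; replace (3 * PI / 2) with (3 * (PI / 2)) by field.
    replace (3 * (PI / 2)) with (PI / 2 + PI) by field.
    rewrite neg_sin, neg_cos, sin_PI2, cos_PI2; (split; [lra|split; [lra|]]); unfold Rdiv; rewrite Rmult_0_l; ring.
- assert (Hq0 : q <> 0) by (unfold q; lra).
  rewrite <- Rmult_assoc, Rinv_r, Rmult_1_l by lra.
  fold q; set (x := 2 * m * d / q).
  pose proof (atan_bound x) as Hb.
  assert (HS : 0 < sqrt (1 + x ^ 2)) by (apply sqrt_lt_R0; pose proof (pow2_ge_0 x); lra).
  set (S := sqrt (1 + x ^ 2)) in *.
  assert (Hx : d = q / (2 * m) * x) by (unfold x; field; lra).
  assert (Hsin : sin (atan x) = x / S) by (rewrite sin_atan; unfold S; now rewrite Rsqr_pow2).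
  assert (Hcos : cos (atan x) = 1 / S) by (rewrite cos_atan; unfold S; now rewrite Rsqr_pow2).
  assert (Hneg : q < 0 -> exists C, 0 <= C /\ d = - C * (x / S) /\ q / (2 * m) = - C * (1 / S)).
  { intros H; exists (- q * S / (2 * m)); repeat split.
    - left; apply Rdiv_lt_0_compat; [apply Rmult_lt_0_compat|]; lra.
    - rewrite Hx at 1; field; lra.
    - field; lra. }
  assert (Hqx : q * x = 2 * m * d) by (unfold x; field; lra).
  unfold beta.
  destruct (Rlt_dec (nu * d) (Rmin 0 (2 * k * (r - c)))) as [H1|H1].
  { pose proof (Rmin_l 0 (2 * k * (r - c))); pose proof (Rmin_r 0 (2 * k * (r - c))).
    assert (Hqn : q < 0) by (unfold q; lra).
    assert (Hd : d < 0) by nra.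
    assert (Hx0 : 0 < x) by nra.
    pose proof (atan_increasing 0 x Hx0) as Ha; rewrite atan_0 in Ha.
    rewrite Rplus_0_l, Hsin, Hcos; split; [lra|now apply Hneg]. }
  destruct (Rlt_dec (2 * k * (r - c)) (nu * d)) as [H2|H2].
  { assert (Hqp : 0 < q) by (unfold q; lra).
    split; [lra|].
    replace (PI + atan x) with (atan x + PI) by ring.
    rewrite neg_sin, neg_cos, Hsin, Hcos.
    exists (q * S / (2 * m)); repeat split.
    - left; apply Rdiv_lt_0_compat; [apply Rmult_lt_0_compat|]; lra.
    - rewrite Hx at 1; field; lra.
    - field; lra. }
  assert (Hqn : q < 0) by (unfold q; lra).
  destruct (Rlt_dec 0 (nu * d)) as [H3|H3].
  { destruct (Rlt_dec (nu * d) (2 * k * (r - c))) as [H4|H4]; [|lra].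
    assert (Hd : 0 < d) by nra.
    assert (Hx0 : x < 0) by nra.
    pose proof (atan_increasing x 0 Hx0) as Ha; rewrite atan_0 in Ha.
    split; [lra|].
    replace (2 * PI + atan x) with (atan x + 2 * INR 1 * PI) by (simpl; ring).
    rewrite sin_period, cos_period, Hsin, Hcos; now apply Hneg. }
  assert (Hd : d = 0).
  { assert (Hd0 : d <= 0) by nra.
    destruct Hd0 as [Hd0|Hd0]; [exfalso|exact Hd0].
    apply H1; apply Rmin_glb_lt; [nra|lra]. }
  assert (Hx0 : x = 0) by (unfold x; rewrite Hd; field; lra).
  assert (Hat : atan x = 0) by (rewrite Hx0; apply atan_0).
  rewrite Hat in Hsin, Hcos |- *.
  rewrite Rplus_0_l, Hsin, Hcos.
  split; [lra|now apply Hneg].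
Qed.

(** With h = nu / 2, the oscillation at ts equals - C M / (k c) exp (- h ts), which
    is nonpositive, and the condition compares its square with (r / c)^2.  Before
    ts the Jacobian decreases on the last half period and increases earlier,
    starting from 1; after ts the energy bounds it. *)
Lemma weak_damping_collapse k c nu :
  0 < k -> 0 < c -> 0 < nu -> nu < 2 * sqrt (k * c) ->
  exists y1 y2, fundamental k c nu y1 y2 /\
    forall r d, 0 < r ->
      collapses c y1 y2 r d <-> weak_damping_condition k c nu r d.
Proof.
intros hk hc hnu hs.
assert (hkc : 0 < k * c) by (apply Rmult_lt_0_compat; lra).
pose proof (sqrt_sqrt _ (Rlt_le _ _ hkc)) as Hsq.
assert (hD : 0 < k * c - nu ^ 2 / 4) by nra.
assert (HM : 0 < mu k c nu) by (apply sqrt_lt_R0, hD).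
assert (HM2 : mu k c nu * mu k c nu = k * c - nu ^ 2 / 4) by (apply sqrt_sqrt; lra).
pose proof (fun r d => tstar_phase k c nu r d HM hnu) as HPh; cbv zeta in HPh.
unfold weak_damping_condition.
set (M := mu k c nu) in *; clearbody M; clear hD hs Hsq.
set (h := nu / 2); assert (Hnu : nu = 2 * h) by (unfold h; field).
assert (Hkc : k * c = h * h + M * M) by (unfold h; lra).
set (y1 := fun t => exp (- h * t) * (cos (M * t) + h / M * sin (M * t))).
set (y2 := fun t => exp (- h * t) * (sin (M * t) / M)).
assert (HF : fundamental k c nu y1 y2).
{ split; unfold y1, y2.
  - rewrite !Rmult_0_r, exp_0, cos_0, sin_0; ring.
  - rewrite !Rmult_0_r, exp_0, sin_0; field; lra.
  - intros t; auto_derive; [easy|]. rewrite Hkc; field; lra.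
  - intros t; auto_derive; [easy|]. rewrite Hnu; field; lra. }
exists y1, y2; split; [exact HF|]; intros r d hr.
destruct (HPh r d) as [Hth [C [HC [Hd Hq]]]]; clear HPh.
set (ts := tstar k c nu r d) in *; clearbody ts.
set (al := (c - r) / c).
assert (Hrc : 0 < r / c) by (apply Rdiv_lt_0_compat; lra).
assert (Hts : 0 <= ts) by (destruct Hth; nra).
set (th := M * ts) in *.
pose proof (sin2_cos2 th) as Hsc; unfold Rsqr in Hsc.
assert (Hka : k * c * al = - C * M * cos th - h * d).
{ assert (Hq' : nu * d + 2 * k * (c - r) = 2 * M * (- C * cos th))
    by (rewrite <- Hq; field; lra).
  replace (k * c * al) with (k * (c - r)) by (unfold al; field; lra).
  rewrite Hnu in Hq'; lra. }
set (W := jacobian c y1 y2 r d).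
set (dW := fun t => d * y1 t - (nu * d + k * (c - r)) * y2 t).
assert (HdW : forall t, is_derive W t (dW t))
  by (intros; now apply (is_derive_jacobian k c nu)).
(* the velocity of W is a damped sine with a zero at ts *)
assert (HdWs : forall t, dW t = C * (exp (- h * t) * sin (M * t - th))).
{ intros t; unfold dW, y1, y2; rewrite sin_minus.
  replace (k * (c - r)) with (- C * M * cos th - h * d)
    by (rewrite <- Hka; unfold al; field; lra).
  rewrite Hnu, Hd; field; lra. }
assert (HWt : forall t, W t - r / c =
  exp (- h * t) * (al * cos (M * t) + (d + h * al) / M * sin (M * t))).
{ intros t; unfold W, jacobian, y1, y2, al; field; lra. }
assert (HWs : W ts = r / c - C * M / (k * c) * exp (- h * ts)).
{ replace (W ts) with (r / c + (W ts - r / c)) by ring; rewrite HWt; fold th.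
  replace (al * cos th + (d + h * al) / M * sin th) with (- (C * M / (k * c))); [ring|].
  apply Rmult_eq_reg_l with (k * c * M); [|apply Rgt_not_eq; now apply Rmult_lt_0_compat].
  replace (k * c * M * (al * cos th + (d + h * al) / M * sin th)) with
    (k * c * al * (M * cos th + h * sin th) + k * c * d * sin th) by (field; lra).
  rewrite Hka, Hkc, Hd.
  replace ((h * h + M * M) * M * - (C * M / (h * h + M * M))) with (- C * M * M * 1)
    by (field; lra).
  rewrite <- Hsc; ring. }
assert (Hiff : (d + nu * (c - r) / (2 * c)) ^ 2 >=
   M ^ 2 * (r ^ 2 / c ^ 2 * (k * c * exp (nu * ts) / M ^ 2 - 1) + (2 * r - c) / c)
   <-> W ts <= 0).
{ replace (d + nu * (c - r) / (2 * c)) with (d + h * al)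
    by (unfold al, h; field; lra).
  set (B := C * M / (k * c)) in *.
  assert (HB : 0 <= B).
  { unfold B; apply Rmult_le_pos; [nra|left; now apply Rinv_0_lt_compat]. }
  assert (Hlhs : (d + h * al) ^ 2 + M ^ 2 * al ^ 2 = k * c * B ^ 2).
  { apply Rmult_eq_reg_l with (k * c); [|lra].
    replace (k * c * (k * c * B ^ 2)) with (C ^ 2 * M ^ 2 * 1)
      by (unfold B; field; lra).
    replace (k * c * ((d + h * al) ^ 2 + M ^ 2 * al ^ 2)) with
      (k * c * d ^ 2 + 2 * h * d * (k * c * al) + (h * h + M * M) * (k * c) * al ^ 2)
      by ring.
    rewrite <- Hkc.
    replace (k * c * (k * c) * al ^ 2) with ((k * c * al) ^ 2) by ring.
    rewrite Hka, Hkc, Hd, <- Hsc; ring. }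
  assert (Hrhs : M ^ 2 * (r ^ 2 / c ^ 2 * (k * c * exp (nu * ts) / M ^ 2 - 1) + (2 * r - c) / c)
    = k * c * (r / c * exp (h * ts)) ^ 2 - M ^ 2 * al ^ 2).
  { replace (nu * ts) with (h * ts + h * ts) by (rewrite Hnu; ring).
    rewrite exp_plus; unfold al; field; lra. }
  rewrite Hrhs, HWs.
  pose proof (exp_pos (h * ts)) as He; pose proof (exp_pos (- h * ts)) as He'.
  assert (Hee : exp (h * ts) * exp (- h * ts) = 1).
  { rewrite <- exp_plus, <- exp_0; f_equal; ring. }
  assert (HX : 0 < r / c * exp (h * ts)) by (now apply Rmult_lt_0_compat).
  transitivity (r / c * exp (h * ts) <= B).
  - split; intros H.
    + apply Rsqr_incr_0; try lra. unfold Rsqr.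
      apply Rmult_le_reg_l with (k * c); [exact hkc|]. lra.
    + assert (H2 : (r / c * exp (h * ts)) ^ 2 <= B ^ 2) by (apply pow_incr; lra).
      apply Rmult_le_compat_l with (r := k * c) in H2; lra.
  - split; intros H.
    + apply Rmult_le_compat_r with (r := exp (- h * ts)) in H; [|lra].
      rewrite Rmult_assoc, Hee in H; lra.
    + apply Rmult_le_reg_r with (exp (- h * ts)); [exact He'|].
      rewrite Rmult_assoc, Hee; lra. }
rewrite Hiff; clear Hiff; unfold collapses; fold W.
split; [|intros H; now exists ts].
intros [t [Ht HWt0]].
destruct (Rle_lt_dec (W ts) 0) as [H|Hpos]; [exact H|exfalso].
assert (Hcont : forall s, continuity_pt W s)
  by (intros s; eapply is_derive_continuity_pt, HdW).
assert (Hsgn : forall s, 0 <= C * exp (- h * s)).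
{ intros s; apply Rmult_le_pos; [exact HC|left; apply exp_pos]. }
destruct (Rle_lt_dec ts t) as [Hlt|Hlt].
- (* past ts the decay of the energy bounds the oscillation *)
  pose proof (fundamental_energy k c nu y1 y2 r d ts t hk hc hnu HF Hlt) as HE.
  cbv beta zeta in HE; fold W in HE.
  change (d * y1 t - (nu * d + k * (c - r)) * y2 t) with (dW t) in HE.
  change (d * y1 ts - (nu * d + k * (c - r)) * y2 ts) with (dW ts) in HE.
  assert (Hz : dW ts = 0).
  { rewrite HdWs; fold th; rewrite Rminus_eq_0, sin_0; ring. }
  rewrite Hz in HE.
  assert (HE' : (W t - r / c) ^ 2 <= (W ts - r / c) ^ 2).
  { apply Rmult_le_reg_l with (k * c); [exact hkc|].
    pose proof (pow2_ge_0 (dW t)); lra. }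
  assert (Hneg : W ts - r / c <= 0).
  { rewrite HWs.
    assert (0 <= C * M / (k * c) * exp (- h * ts)); [|lra].
    apply Rmult_le_pos; [|left; apply exp_pos].
    apply Rmult_le_pos; [nra|left; now apply Rinv_0_lt_compat]. }
  nra.
- destruct (Rle_lt_dec (th - PI) (M * t)) as [Hp|Hp].
  + (* W decreases on the half period before ts *)
    assert (W ts <= W t); [|lra].
    apply (nonincreasing_of_derive W dW t ts); [lra|auto|].
    intros s Hs; split; [apply HdW|].
    rewrite HdWs, <- Rmult_assoc; apply Rmult_le_0_l; [apply Hsgn|].
    assert (M * t <= M * s <= th) by (unfold th; split; apply Rmult_le_compat_l; lra).
    replace (M * s - th) with (- (th - M * s)) by ring; rewrite sin_neg.
    assert (0 <= sin (th - M * s)) by (apply sin_ge_0; lra). lra.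
  + (* and increases on the half period before that *)
    assert (HW0 : W 0 = 1).
    { unfold W, jacobian; rewrite (fund_y1_0 _ _ _ _ _ HF), (fund_y2_0 _ _ _ _ _ HF).
      field; lra. }
    assert (W 0 <= W t); [|lra].
    apply (nondecreasing_of_derive W dW 0 t); [lra|auto|].
    intros s Hs; split; [apply HdW|].
    rewrite HdWs, <- Rmult_assoc; apply Rmult_le_pos; [apply Hsgn|].
    assert (0 <= M * s <= M * t) by (split; [nra|apply Rmult_le_compat_l; lra]).
    replace (sin (M * s - th)) with (sin (M * s - th + 2 * INR 1 * PI)) by apply sin_period.
    simpl; apply sin_ge_0; lra.
Qed.

Lemma damping_collapse k c nu :
  0 < k -> 0 < c -> 0 < nu ->
  exists y1 y2, fundamental k c nu y1 y2 /\
    forall r d, 0 < r ->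
      collapses c y1 y2 r d <->
      (nu > 2 * sqrt (k * c) -> strong_damping_condition k c nu r d) /\
      (nu = 2 * sqrt (k * c) -> borderline_damping_condition c nu r d) /\
      (nu < 2 * sqrt (k * c) -> weak_damping_condition k c nu r d).
Proof.
intros hk hc hnu.
destruct (Rtotal_order nu (2 * sqrt (k * c))) as [H|[H|H]].
- destruct (weak_damping_collapse k c nu hk hc hnu H) as [y1 [y2 [HF HC]]].
  exists y1, y2; split; [exact HF|]; intros r d hr; rewrite (HC r d hr).
  split; [intros HW; repeat split; try lra; auto|tauto].
- destruct (borderline_damping_collapse k c nu hk hc hnu H) as [y1 [y2 [HF HC]]].
  exists y1, y2; split; [exact HF|]; intros r d hr; rewrite (HC r d hr).
  split; [intros HW; split; [intros; lra|split; [auto|intros; lra]]|tauto].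
- destruct (strong_damping_collapse k c nu hk hc hnu H) as [y1 [y2 [HF HC]]].
  exists y1, y2; split; [exact HF|]; intros r d hr; rewrite (HC r d hr).
  split; [intros HW; split; [auto|split; intros; lra]|tauto].
Qed.

(** * Characteristics of a given solution *)

(** The fields are taken continuous for all times, which the time clamp below
    provides, and the equations are assumed on (0, T) only.  The momentum
    equation enters through the derivative in x of the acceleration, where the
    potential no longer appears. *)
Section Characteristics.

Variables (k c nu T : R) (y1 y2 : R -> R) (rho u ux ut rt : R -> R -> R).
Hypotheses (hk : 0 < k) (hc : 0 < c) (hT : 0 < T).
Hypothesis HF : fundamental k c nu y1 y2.
Hypothesis rho_cont : forall x t, continuity_2d_pt rho x t.
Hypothesis u_cont : forall x t, continuity_2d_pt u x t.
Hypothesis ux_cont : forall x t, continuity_2d_pt ux x t.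
Hypothesis ut_cont : forall x t, continuity_2d_pt ut x t.
Hypothesis rt_cont : forall x t, continuity_2d_pt rt x t.
Hypothesis hux : forall x t, 0 <= t <= T -> is_derive (fun y => u y t) x (ux x t).
Hypothesis hut : forall x t, 0 < t < T -> is_derive (u x) t (ut x t).
Hypothesis hrt : forall x t, 0 < t < T -> is_derive (rho x) t (rt x t).
Hypothesis hmass : forall x t, 0 < t < T ->
  is_derive (fun y => rho y t * u y t) x (- rt x t).
Hypothesis hforce : forall x t, 0 < t < T ->
  is_derive (fun y => ut y t + u y t * ux y t + nu * u y t) x (k * (rho x t - c)).

Definition flux0 (t : R) : R := RInt (fun s => rho 0 s * u 0 s) 0 t.

(** A potential of (rho - c, - rho u): it is the field - phi_x up to a function
    of time, but it is differentiable in t by construction. *)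
Definition excess (x t : R) : R := RInt (fun y => rho y t - c) 0 x - flux0 t.

Lemma flux0_derive t : is_derive flux0 t (rho 0 t * u 0 t).
Proof.
apply (is_derive_RInt_continuity (fun s => rho 0 s * u 0 s)).
intros s; apply continuity_pt_mult; now apply continuity_pt_slice_t.
Qed.

Lemma excess_dx x t : is_derive (fun y => excess y t) x (rho x t - c).
Proof.
apply (is_derive_eq _ _ ((rho x t - c) - 0)); [|ring].
apply (is_derive_minus (fun y => RInt (fun z => rho z t - c) 0 y) (fun _ => flux0 t)).
- apply (is_derive_RInt_continuity (fun z => rho z t - c)).
  intros y; apply continuity_pt_minus; [now apply continuity_pt_slice_x|const_pt].
- apply (is_derive_const (V := R_NormedModule)).
Qed.

Lemma excess_cont x t : continuity_2d_pt excess x t.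
Proof.
apply continuity_2d_pt_minus.
- apply (continuity_2d_pt_RInt (fun y s => rho y s - c)); intros y s.
  apply continuity_2d_pt_minus; [auto|apply continuity_2d_pt_const].
- apply continuity_2d_pt_snd. eapply is_derive_continuity_pt, flux0_derive.
Qed.

(** Differentiation under the integral sign and the mass equation; the flux at
    x = 0 is compensated by [flux0]. *)
Lemma excess_dt x t : 0 < t < T -> is_derive (excess x) t (- (rho x t * u x t)).
Proof.
intros Ht.
apply (is_derive_eq _ _ ((- (rho x t * u x t) + rho 0 t * u 0 t) - rho 0 t * u 0 t));
  [|ring].
apply (is_derive_minus (fun s => RInt (fun z => rho z s - c) 0 x) flux0);
  [|apply flux0_derive].
assert (HD : forall y s, 0 < s < T -> is_derive (fun z => rho y z - c) s (rt y s)).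
{ intros y s Hs; apply (is_derive_eq _ _ (rt y s - 0)); [|ring].
  apply (is_derive_minus (rho y) (fun _ => c)); [now apply hrt|].
  apply (is_derive_const (V := R_NormedModule)). }
eapply is_derive_eq.
- apply (is_derive_RInt_param (fun s y => rho y s - c)).
  + eapply filter_imp; [|apply (locally_open_interval 0 T t Ht)].
    intros s Hs y _; exists (rt y s); now apply HD.
  + intros y _.
    apply continuity_2d_pt_ext_loc with (fun s y => rt y s).
    * destruct (locally_open_interval 0 T t Ht) as [del Hdel].
      exists del; intros s z Hs _; symmetry; apply is_derive_unique, HD.
      apply Hdel, Hs.
    * apply (continuity_2d_pt_comp rt (fun s y => y) (fun s y => s)); auto.
      apply continuity_2d_pt_id2. apply continuity_2d_pt_id1.
  + apply filter_forall; intros s; apply ex_RInt_continuity; intros y.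
    apply continuity_pt_minus; [now apply continuity_pt_slice_x|const_pt].
- rewrite (RInt_ext _ (fun y => rt y t)).
  2:{ intros y _; apply is_derive_unique, HD, Ht. }
  apply is_RInt_unique.
  assert (HR : is_RInt (fun y => rt y t) 0 x
     (minus (- (rho x t * u x t)) (- (rho 0 t * u 0 t)))).
  { apply (is_RInt_derive (fun y => - (rho y t * u y t))).
    - intros y _; apply (is_derive_eq _ _ (- - rt y t)); [|ring].
      apply (is_derive_opp (fun y => rho y t * u y t)); now apply hmass.
    - intros y _; apply continuity_pt_filterlim. now apply continuity_pt_slice_x. }
  replace (- (rho x t * u x t) + rho 0 t * u 0 t)
    with (minus (- (rho x t * u x t)) (- (rho 0 t * u 0 t))); [exact HR|].
  unfold minus, plus, opp; simpl; ring.
Qed.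

(** The part of - phi_x that depends on time alone, read off at x = 0. *)
Definition drive (t : R) : R :=
  (ut 0 t + u 0 t * ux 0 t + nu * u 0 t) / k + flux0 t.

Lemma drive_cont : continuity drive.
Proof.
intros t; unfold drive, Rdiv.
repeat first [ apply continuity_pt_plus | apply continuity_pt_mult
  | now apply continuity_pt_slice_t | const_pt
  | eapply is_derive_continuity_pt, flux0_derive ].
Qed.

Lemma force_excess x t : 0 < t < T ->
  ut x t + u x t * ux x t + nu * u x t = k * (drive t + excess x t).
Proof.
intros Ht.
set (G := fun y => ut y t + u y t * ux y t + nu * u y t - k * excess y t).
assert (HG : G x = G 0).
{ apply is_derive_constant; intros y; unfold G.
  apply (is_derive_eq _ _ (k * (rho y t - c) - k * (rho y t - c))); [|ring].
  apply (is_derive_minus (fun y => ut y t + u y t * ux y t + nu * u y t)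
     (fun y => k * excess y t)).
  - now apply hforce.
  - apply is_derive_scal, excess_dx. }
unfold G, excess in HG; rewrite RInt_point in HG.
unfold zero in HG; simpl in HG.
unfold drive, excess.
replace (ut x t + u x t * ux x t + nu * u x t) with
  (k * (RInt (fun y => rho y t - c) 0 x - flux0 t)
   + (ut 0 t + u 0 t * ux 0 t + nu * u 0 t - k * (0 - flux0 t))) by lra.
field; lra.
Qed.

Lemma path_bounded (g : R -> R) :
  continuity g -> exists B, 0 <= B /\ forall t, 0 <= t <= T -> Rabs (g t) <= B.
Proof.
intros Hg.
destruct (continuity_ab_maj (fun t => Rabs (g t)) 0 T) as [t0 [H0 _]]; [lra| |].
- intros t _; apply (continuity_pt_comp g Rabs); [apply Hg|apply Rcontinuity_abs].
- exists (Rabs (g t0)); split; [apply Rabs_pos|exact H0].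
Qed.

Definition mass0 (a : R) : R := RInt (fun y => rho y 0 - c) 0 a.

(** The position Y solves Y'' + nu Y' = k (drive + mass0 a - c (Y - a)).  The
    defects z = u (Y, t) - Y' and e = excess (Y, t) - mass0 a + c (Y - a) satisfy
    z' = - (u_x + nu) z + k e and e' = - rho z with zero initial values, so both
    vanish.  The forcing p is common to all labels. *)
Lemma characteristics :
  exists p : R -> R, forall a t, 0 <= t <= T ->
    let Y := p t + a + mass0 a * ((1 - y1 t) / c) + u a 0 * y2 t in
    excess Y t = mass0 a - c * (Y - a).
Proof.
destruct (forced_oscillation k c nu y1 y2 drive HF drive_cont)
  as [p [q [Hp0 [Hq0 Hpq]]]].
exists p; intros a t Ht; cbv zeta.
destruct HF as [H10 H20 H1 H2].
set (N := mass0 a); set (v := u a 0).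
set (Y := fun t => p t + a + N * ((1 - y1 t) / c) + v * y2 t).
set (V := fun t => q t + N * (k * y2 t) + v * (y1 t - nu * y2 t)).
change (excess (Y t) t = N - c * (Y t - a)).
assert (HY : forall s, is_derive Y s (V s)).
{ intros s; specialize (H1 s); specialize (H2 s); destruct (Hpq s) as [H3 _].
  unfold Y, V; auto_derive; [repeat split; eexists; eassumption|].
  rewrite (is_derive_unique (fun x : R => y1 x) _ _ H1),
          (is_derive_unique (fun x : R => y2 x) _ _ H2),
          (is_derive_unique (fun x : R => p x) _ _ H3).
  field; lra. }
assert (HV : forall s, is_derive V s
   (- nu * V s + k * (drive s + (N - c * (Y s - a))))).
{ intros s; specialize (H1 s); specialize (H2 s); destruct (Hpq s) as [_ H3].
  unfold V, Y; auto_derive; [repeat split; eexists; eassumption|].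
  rewrite (is_derive_unique (fun x : R => y1 x) _ _ H1),
          (is_derive_unique (fun x : R => y2 x) _ _ H2),
          (is_derive_unique (fun x : R => q x) _ _ H3).
  field; lra. }
assert (HYc : continuity Y) by (intros s; eapply is_derive_continuity_pt, HY).
assert (HVc : continuity V) by (intros s; eapply is_derive_continuity_pt, HV).
assert (Hpath : forall f, (forall x t, continuity_2d_pt f x t) ->
          continuity (fun s => f (Y s) s)).
{ intros f Hf s; apply (continuity_2d_pt_path f Y (fun s => s)); auto.
  apply continuity_pt_id. }
destruct (path_bounded _ (Hpath ux ux_cont)) as [B1 [HB1 HB1']].
destruct (path_bounded _ (Hpath rho rho_cont)) as [B2 [HB2 HB2']].
set (z := fun s => u (Y s) s - V s).
set (e := fun s => excess (Y s) s - (N - c * (Y s - a))).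
enough (z t = 0 /\ e t = 0) as [_ He] by (unfold e in He; lra).
apply (linear_system_zero z e
   (fun s => - (ux (Y s) s + nu) * z s + k * e s) (fun s => - rho (Y s) s * z s)
   (B1 + Rabs nu + k + B2) T).
- pose proof (Rabs_pos nu); lra.
- intros s _; split.
  + apply continuity_pt_minus; [apply (Hpath u u_cont)|apply HVc].
  + apply continuity_pt_minus; [apply (Hpath excess excess_cont)|].
    apply continuity_pt_minus; [const_pt|].
    apply continuity_pt_mult; [const_pt|].
    apply continuity_pt_minus; [apply HYc|const_pt].
- intros s Hs; split.
  + apply (is_derive_eq _ _ ((ux (Y s) s * V s + ut (Y s) s)
       - (- nu * V s + k * (drive s + (N - c * (Y s - a)))))).
    * apply (is_derive_minus (fun s => u (Y s) s) V); [|apply HV].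
      apply is_derive_comp_2d; auto.
      destruct (locally_open_interval 0 T s Hs) as [del Hdel].
      exists del; intros [y r] [_ Hr]; simpl in *.
      apply hux; specialize (Hdel r Hr); lra.
    * pose proof (force_excess (Y s) s Hs). unfold z, e. lra.
  + apply (is_derive_eq _ _ (((rho (Y s) s - c) * V s + - (rho (Y s) s * u (Y s) s))
       - (0 - c * (V s - 0)))); [|unfold z; ring].
    apply (is_derive_minus (fun s => excess (Y s) s)).
    * apply (is_derive_comp_2d excess (fun x t => rho x t - c)).
      -- apply filter_forall; intros [y r]; apply excess_dx.
      -- apply continuity_2d_pt_minus; [auto|apply continuity_2d_pt_const].
      -- now apply excess_dt.
      -- apply HY.
    * apply (is_derive_minus (fun _ => N) (fun s => c * (Y s - a)));
        [apply (is_derive_const (V := R_NormedModule))|].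
      apply is_derive_scal.
      apply (is_derive_minus Y (fun _ => a)); [apply HY|].
      apply (is_derive_const (V := R_NormedModule)).
- intros s Hs.
  specialize (HB1' s ltac:(lra)); specialize (HB2' s ltac:(lra)); simpl in HB1', HB2'.
  pose proof (Rabs_pos (z s)); pose proof (Rabs_pos (e s)); pose proof (Rabs_pos nu).
  assert (Rabs (ux (Y s) s + nu) * Rabs (z s) <= (B1 + Rabs nu) * Rabs (z s)).
  { apply Rmult_le_compat_r; [lra|].
    eapply Rle_trans; [apply Rabs_triang|lra]. }
  assert (Rabs (rho (Y s) s) * Rabs (z s) <= B2 * Rabs (z s))
    by (apply Rmult_le_compat_r; lra).
  assert (0 <= B1 * Rabs (e s)) by (apply Rmult_le_pos; lra).
  assert (0 <= B2 * Rabs (e s)) by (apply Rmult_le_pos; lra).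
  assert (0 <= B2 * Rabs (z s)) by (apply Rmult_le_pos; lra).
  assert (0 <= B1 * Rabs (z s)) by (apply Rmult_le_pos; lra).
  assert (0 <= k * Rabs (e s)) by (apply Rmult_le_pos; lra).
  assert (0 <= k * Rabs (z s)) by (apply Rmult_le_pos; lra).
  assert (0 <= Rabs nu * Rabs (z s)) by (apply Rmult_le_pos; lra).
  assert (0 <= Rabs nu * Rabs (e s)) by (apply Rmult_le_pos; lra).
  split.
  + eapply Rle_trans; [apply Rabs_triang|].
    rewrite !Rabs_mult, Rabs_Ropp, (Rabs_pos_eq k) by lra. lra.
  + rewrite Rabs_mult, Rabs_Ropp. lra.
- unfold z, Y, V; rewrite Hp0, Hq0, H10, H20.
  replace (0 + a + N * ((1 - 1) / c) + v * 0) with a by (field; lra).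
  unfold v; ring.
- unfold e, Y; rewrite Hp0, H10, H20.
  replace (0 + a + N * ((1 - 1) / c) + v * 0) with a by (field; lra).
  unfold excess, flux0; rewrite RInt_point; unfold N, mass0, zero; simpl; ring.
- exact Ht.
Qed.

End Characteristics.

(** Freezing time outside [0, T] extends a function continuous on a strip to one
    continuous on the plane, which removes one-sided limits from the
    argument. *)
Definition clamp (T t : R) : R := Rmax 0 (Rmin t T).

Lemma clamp_range T t : 0 <= T -> 0 <= clamp T t <= T.
Proof.
intros HT; unfold clamp; split; [apply Rmax_l|].
apply Rmax_lub; [exact HT|apply Rmin_r].
Qed.

Lemma clamp_id T t : 0 <= t <= T -> clamp T t = t.
Proof. intros Ht; unfold clamp; rewrite Rmin_left, Rmax_right; lra. Qed.

Lemma clamp_lipschitz T s t : Rabs (clamp T s - clamp T t) <= Rabs (s - t).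
Proof.
unfold clamp, Rmax, Rmin.
destruct (Rle_dec s T), (Rle_dec t T);
repeat match goal with |- context [Rle_dec ?a ?b] => destruct (Rle_dec a b) end;
unfold Rabs; repeat destruct Rcase_abs; lra.
Qed.

Lemma continuous_strip_clamp T T1 (f : R -> R -> R) :
  0 <= T1 < T -> continuous_strip T f ->
  forall x t, continuity_2d_pt (fun y s => f y (clamp T1 s)) x t.
Proof.
intros HT Hf x t; pose proof (clamp_range T1 t (proj1 HT)) as Ht.
assert (Ht' : 0 <= clamp T1 t < T) by lra.
intros eps; specialize (Hf x (clamp T1 t) Ht').
apply filterlim_locally with (eps := eps) in Hf.
destruct Hf as [del Hdel]; exists del; intros y s Hy Hs.
apply (Hdel (y, clamp T1 s)).
- split; simpl.
  + exact Hy.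
  + eapply Rle_lt_trans; [apply clamp_lipschitz|exact Hs].
- simpl; pose proof (clamp_range T1 s (proj1 HT)); lra.
Qed.

Lemma is_C1_continuity f : is_C1 f -> continuity f.
Proof. intros Hf x; apply continuity_pt_filterlim, (ex_derive_continuous f), Hf. Qed.

Lemma is_C1_derive f x : is_C1 f -> is_derive f x (Derive f x).
Proof. intros Hf; apply Derive_correct, Hf. Qed.

(** The identity rho w = rho0 comes from differentiating
    excess (Y, t) = N - c (Y - a) with respect to the label a. *)
Lemma EP_characteristics k c nu rho0 u0 T rho u phi y1 y2 T1 :
  0 < k -> 0 < c -> is_C1 rho0 -> is_C1 u0 ->
  EP_solution k c nu rho0 u0 T rho u phi -> fundamental k c nu y1 y2 ->
  0 < T1 < T ->
  exists p C : R -> R, forall a t, 0 <= t <= T1 ->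
    let N := RInt (fun y => rho0 y - c) 0 a in
    let Y := p t + a + N * ((1 - y1 t) / c) + u0 a * y2 t in
    rho Y t * jacobian c y1 y2 (rho0 a) (Derive u0 a) t = rho0 a /\
    (0 < t < T1 -> dx phi Y t = C t - (N - c * (Y - a))).
Proof.
intros hk hc Hr0 Hu0 HS HF HT1.
destruct HS as [Hrho Hu Hp1 Hp2 Hmass Hmom Hpois _ _ Hri Hui].
destruct Hrho as [Hrho [Hrx [Hrxc [rt [Hrt Hrt']]]]].
destruct Hu as [Hu [Hux [Huxc [ut [Hut Hut']]]]].
assert (HT : 0 <= T1 < T) by lra.
set (r' := fun y s => rho y (clamp T1 s)).
set (u' := fun y s => u y (clamp T1 s)).
set (ux' := fun y s => dx u y (clamp T1 s)).
set (ut' := fun y s => ut y (clamp T1 s)).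
set (rt' := fun y s => rt y (clamp T1 s)).
assert (Hcl : forall t, 0 < t < T1 -> clamp T1 t = t) by (intros; apply clamp_id; lra).
assert (Hloc : forall (f : R -> R -> R) x t, 0 < t < T1 ->
          locally t (fun s => f x s = f x (clamp T1 s))).
{ intros f x t Ht; eapply filter_imp; [|apply (locally_open_interval 0 T1 t Ht)].
  intros s Hs; simpl; now rewrite Hcl. }
assert (Hr'c : forall x t, continuity_2d_pt r' x t) by (now apply (continuous_strip_clamp T)).
assert (Hu'c : forall x t, continuity_2d_pt u' x t) by (now apply (continuous_strip_clamp T)).
assert (Hux'c : forall x t, continuity_2d_pt ux' x t) by (now apply (continuous_strip_clamp T)).
assert (Hut'c : forall x t, continuity_2d_pt ut' x t) by (now apply (continuous_strip_clamp T)).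
assert (Hrt'c : forall x t, continuity_2d_pt rt' x t) by (now apply (continuous_strip_clamp T)).
assert (Hux' : forall x t, 0 <= t <= T1 -> is_derive (fun y => u' y t) x (ux' x t)).
{ intros x t Ht; unfold u', ux', dx; rewrite clamp_id by exact Ht.
  apply Derive_correct, Hux; lra. }
assert (Hut'd : forall x t, 0 < t < T1 -> is_derive (u' x) t (ut' x t)).
{ intros x t Ht; unfold ut'; rewrite Hcl by exact Ht.
  apply (is_derive_ext_loc (u x)); [now apply Hloc|apply Hut'; lra]. }
assert (Hrt'd : forall x t, 0 < t < T1 -> is_derive (r' x) t (rt' x t)).
{ intros x t Ht; unfold rt'; rewrite Hcl by exact Ht.
  apply (is_derive_ext_loc (rho x)); [now apply Hloc|apply Hrt'; lra]. }
assert (Hm' : forall x t, 0 < t < T1 ->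
          is_derive (fun y => r' y t * u' y t) x (- rt' x t)).
{ intros x t Ht; unfold r', u', rt'; rewrite !Hcl by exact Ht.
  apply (is_derive_eq _ _ (dx (fun y s => rho y s * u y s) x t)).
  - apply Derive_correct.
    apply (ex_derive_mult (fun y => rho y t) (fun y => u y t));
      [apply Hrx|apply Hux]; lra.
  - assert (Hd : dt rho x t = rt x t) by (apply is_derive_unique, Hrt'; lra).
    specialize (Hmass x t ltac:(lra)); rewrite Hd in Hmass; lra. }
assert (Hpxx : forall x t, 0 < t < T1 ->
          is_derive (fun y => dx phi y t) x (- (rho x t - c))).
{ intros x t Ht; apply (is_derive_eq _ _ (dx (dx phi) x t)).
  - apply (Derive_correct (fun y => dx phi y t)), Hp2; lra.
  - rewrite <- (Hpois x t) by lra; ring. }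
assert (Hf' : forall x t, 0 < t < T1 ->
   is_derive (fun y => ut' y t + u' y t * ux' y t + nu * u' y t) x
     (k * (r' x t - c))).
{ intros x t Ht; unfold ut', u', ux', r'; rewrite Hcl by exact Ht.
  apply (is_derive_ext (fun y => - k * dx phi y t)).
  - intros y; assert (Hd : dt u y t = ut y t) by (apply is_derive_unique, Hut'; lra).
    specialize (Hmom y t ltac:(lra)); rewrite Hd in Hmom; lra.
  - apply (is_derive_eq _ _ (- k * (- (rho x t - c)))); [|ring].
    now apply is_derive_scal, Hpxx. }
destruct (characteristics k c nu T1 y1 y2 r' u' ux' ut' rt' hk hc ltac:(lra) HF
  Hr'c Hu'c Hux'c Hut'c Hrt'c Hux' Hut'd Hrt'd Hm' Hf') as [p Hp].
assert (Hr'0 : forall a, r' a 0 = rho0 a).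
{ intros a; unfold r'; rewrite clamp_id by lra; apply Hri. }
assert (Hu'0 : forall a, u' a 0 = u0 a).
{ intros a; unfold u'; rewrite clamp_id by lra; apply Hui. }
set (N := (fun a => RInt (fun y => rho0 y - c) 0 a) : R -> R).
assert (HN : forall a, mass0 c r' a = N a).
{ intros a; apply RInt_ext; intros y _; now rewrite Hr'0. }
assert (HNd : forall a, is_derive N a (rho0 a - c)).
{ intros a; apply (is_derive_RInt_continuity (fun y => rho0 y - c)).
  intros y; apply continuity_pt_minus; [now apply is_C1_continuity|const_pt]. }
set (Y := fun a t => p t + a + N a * ((1 - y1 t) / c) + u0 a * y2 t).
assert (HE : forall a t, 0 <= t <= T1 ->
          excess c r' u' (Y a t) t = N a - c * (Y a t - a)).
{ intros a t Ht; specialize (Hp a t Ht); cbv zeta in Hp.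
  rewrite HN, Hu'0 in Hp; exact Hp. }
exists p, (fun t => dx phi 0 t + excess c r' u' 0 t).
intros a t Ht; fold (N a); cbv zeta.
change (p t + a + N a * ((1 - y1 t) / c) + u0 a * y2 t) with (Y a t).
split.
- set (w := jacobian c y1 y2 (rho0 a) (Derive u0 a) t).
  assert (HYd : is_derive (fun b => Y b t) a w).
  { specialize (HNd a); pose proof (is_C1_derive u0 a Hu0) as Hu0d.
    unfold Y; auto_derive; [split; [eexists; exact HNd|split; [eexists; exact Hu0d|easy]]|].
    rewrite (is_derive_unique (fun x : R => N x) _ _ HNd).
    unfold w, jacobian.
    change (Derive (fun x => u0 x) a) with (Derive u0 a); field; lra. }
  assert (H1 : is_derive (fun b => excess c r' u' (Y b t) t) a (w * (r' (Y a t) t - c))).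
  { apply (is_derive_comp (fun y => excess c r' u' y t) (fun b => Y b t)); [|exact HYd].
    now apply excess_dx. }
  assert (H2 : is_derive (fun b => excess c r' u' (Y b t) t) a
     ((rho0 a - c) - c * (w - 1))).
  { apply (is_derive_ext (fun b => N b - c * (Y b t - b))).
    - intros b; symmetry; now apply HE.
    - apply (is_derive_minus N (fun b => c * (Y b t - b))); [apply HNd|].
      apply is_derive_scal.
      apply (is_derive_minus (fun b => Y b t) (fun b => b)); [exact HYd|].
      apply (is_derive_id (K := R_AbsRing)). }
  apply is_derive_unique in H1; apply is_derive_unique in H2.
  rewrite H1 in H2; unfold r' in H2; rewrite clamp_id in H2 by exact Ht.
  lra.
- intros Ht'; rewrite <- HE by exact Ht.
  set (g := fun y => dx phi y t + excess c r' u' y t).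
  enough (g (Y a t) = g 0) as Hg by (unfold g in Hg; lra).
  apply is_derive_constant; intros y.
  apply (is_derive_eq _ _ (- (rho y t - c) + (r' y t - c))).
  + apply (is_derive_plus (fun y => dx phi y t) (fun y => excess c r' u' y t)).
    * now apply Hpxx.
    * now apply excess_dx.
  + unfold r'; rewrite Hcl by exact Ht'; ring.
Qed.

Lemma EP_jacobian_pos k c nu rho0 u0 T rho u phi y1 y2 :
  0 < k -> 0 < c -> is_C1 rho0 -> is_C1 u0 -> (forall x, 0 < rho0 x) ->
  EP_solution k c nu rho0 u0 T rho u phi -> fundamental k c nu y1 y2 ->
  forall a t, 0 <= t < T -> 0 < jacobian c y1 y2 (rho0 a) (Derive u0 a) t.
Proof.
intros hk hc Hr0 Hu0 Hpos HS HF a t Ht.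
destruct (EP_characteristics k c nu rho0 u0 T rho u phi y1 y2 ((t + T) / 2)
  hk hc Hr0 Hu0 HS HF ltac:(lra)) as [p [C HpC]].
apply (positive_of_nonzero (jacobian c y1 y2 (rho0 a) (Derive u0 a)) t); [| | |lra].
- intros s; eapply is_derive_continuity_pt.
  now apply (is_derive_jacobian k c nu).
- unfold jacobian; rewrite (fund_y1_0 _ _ _ _ _ HF), (fund_y2_0 _ _ _ _ _ HF).
  replace (1 + (rho0 a - c) * ((1 - 1) / c) + Derive u0 a * 0) with 1 by (field; lra).
  lra.
- intros s Hs H0; destruct (HpC a s ltac:(lra)) as [H1 _].
  rewrite H0 in H1; specialize (Hpos a); lra.
Qed.

(** * Regularity forced on the initial data *)

Lemma is_C1_intro (f df : R -> R) :
  (forall x, is_derive f x (df x)) -> continuity df -> is_C1 f.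
Proof.
intros Hf Hc x; split; [now exists (df x)|].
apply (continuous_ext df).
- intros y; symmetry; apply is_derive_unique, Hf.
- apply continuity_pt_filterlim, Hc.
Qed.

Lemma is_C1_continuity_derive f : is_C1 f -> continuity (Derive f).
Proof. intros Hf x; apply continuity_pt_filterlim, Hf. Qed.

(** If Y stayed below some bound, its values would remain in a compact interval,
    on which K is bounded. *)
Lemma increasing_unbounded_p (K Y : R -> R) :
  (forall a b, a < b -> Y a < Y b) -> continuity K ->
  is_lim (fun a => K (Y a)) p_infty p_infty -> is_lim Y p_infty p_infty.
Proof.
intros HY HK HKY; apply is_lim_spec; intros M.
apply is_lim_spec in HKY.
set (M' := Rmax (Y 0) M).
destruct (continuity_ab_maj K (Y 0) M') as [y0 [Hy0 _]];
  [apply Rmax_l|intros; apply HK|].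
destruct (HKY (K y0)) as [A HA].
exists (Rmax 0 A); intros a Ha.
assert (0 < a) by (eapply Rle_lt_trans; [apply Rmax_l|exact Ha]).
assert (A < a) by (eapply Rle_lt_trans; [apply Rmax_r|exact Ha]).
specialize (HA a ltac:(lra)).
destruct (Rlt_le_dec M (Y a)) as [HM|HM]; [exact HM|exfalso].
specialize (HY 0 a ltac:(lra)).
assert (Y a <= M') by (eapply Rle_trans; [exact HM|apply Rmax_r]).
specialize (Hy0 (Y a) ltac:(lra)); lra.
Qed.

Lemma increasing_unbounded_m (K Y : R -> R) :
  (forall a b, a < b -> Y a < Y b) -> continuity K ->
  is_lim (fun a => K (Y a)) m_infty m_infty -> is_lim Y m_infty m_infty.
Proof.
intros HY HK HKY; apply is_lim_spec; intros M.
apply is_lim_spec in HKY.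
set (M' := Rmin (Y 0) M).
destruct (continuity_ab_min K M' (Y 0)) as [y0 [Hy0 _]];
  [apply Rmin_l|intros; apply HK|].
destruct (HKY (K y0)) as [A HA].
exists (Rmin 0 A); intros a Ha.
assert (a < 0) by (eapply Rlt_le_trans; [exact Ha|apply Rmin_l]).
assert (a < A) by (eapply Rlt_le_trans; [exact Ha|apply Rmin_r]).
specialize (HA a ltac:(lra)).
destruct (Rlt_le_dec (Y a) M) as [HM|HM]; [exact HM|exfalso].
specialize (HY a 0 ltac:(lra)).
assert (M' <= Y a) by (eapply Rle_trans; [apply Rmin_r|exact HM]).
specialize (Hy0 (Y a) ltac:(lra)); lra.
Qed.

Lemma continuous_strip_x T f t :
  0 <= t < T -> continuous_strip T f -> continuity (fun y => f y t).
Proof.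
intros Ht Hf x.
apply (continuity_pt_ext (fun y => f y (clamp t t))).
- intros y; rewrite clamp_id by lra; reflexivity.
- apply (continuity_pt_slice_x (fun y s => f y (clamp t s))).
  now apply (continuous_strip_clamp T).
Qed.

(** At a small time t with y2 t > 0, both rho (., t) and Y are C^1, hence so is
    w = rho0 / rho (Y, t), and u0' is a combination of w and rho0.  For the
    limits, phi_x (Y (a), t) equals c (Y (a) - a) up to a constant and the
    convergent integral of rho0 - c; neutrality at time t gives it equal limits
    at both ends, provided that Y (a) goes to infinity with a.  The latter holds
    because - phi_x (y) + c y, a primitive of the density, is bounded on bounded
    sets and unbounded along Y. *)
Lemma EP_data_regular k c nu rho0 u0 T rho u phi y1 y2 :
  0 < k -> 0 < c -> 0 < T -> is_C1 rho0 -> is_C1 u0 -> (forall x, 0 < rho0 x) ->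
  is_RInt_line (fun x => rho0 x - c) 0 ->
  EP_solution k c nu rho0 u0 T rho u phi -> fundamental k c nu y1 y2 ->
  is_C1 (Derive u0) /\
  exists L : R, is_lim u0 m_infty L /\ is_lim u0 p_infty L.
Proof.
intros hk hc HT Hr0 Hu0 Hpos Hneu HS HF.
destruct (fundamental_y2_pos _ _ _ _ _ HF) as [del [Hdel Hy2]].
set (t := Rmin del T / 2).
assert (Ht : 0 < t < del /\ t < T).
{ pose proof (Rmin_l del T); pose proof (Rmin_r del T).
  pose proof (Rmin_pos del T Hdel HT); unfold t; lra. }
specialize (Hy2 t ltac:(lra)).
destruct (EP_characteristics k c nu rho0 u0 T rho u phi y1 y2 ((t + T) / 2)
  hk hc Hr0 Hu0 HS HF ltac:(lra)) as [p [C HpC]].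
pose proof (EP_jacobian_pos k c nu rho0 u0 T rho u phi y1 y2 hk hc Hr0 Hu0 Hpos
  HS HF) as Hw.
set (N := (fun a => RInt (fun y => rho0 y - c) 0 a) : R -> R).
assert (Hr0c : continuity (fun y => rho0 y - c)).
{ intros y; apply continuity_pt_minus; [now apply is_C1_continuity|const_pt]. }
assert (HNd : forall a, is_derive N a (rho0 a - c)).
{ intros a; now apply (is_derive_RInt_continuity (fun y => rho0 y - c)). }
set (w := fun a => jacobian c y1 y2 (rho0 a) (Derive u0 a) t).
assert (Hw0 : forall a, 0 < w a) by (intros; apply Hw; lra); clear Hw.
set (Y := fun a => p t + a + N a * ((1 - y1 t) / c) + u0 a * y2 t).
assert (HYd : forall a, is_derive Y a (w a)).
{ intros a; specialize (HNd a); pose proof (is_C1_derive u0 a Hu0) as Hu0d.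
  unfold Y; auto_derive; [split; [eexists; exact HNd|split; [eexists; exact Hu0d|easy]]|].
  rewrite (is_derive_unique (fun x : R => N x) _ _ HNd).
  unfold w, jacobian.
  change (Derive (fun x => u0 x) a) with (Derive u0 a); field; lra. }
assert (HYc : continuity Y) by (intros a; eapply is_derive_continuity_pt, HYd).
assert (Hinc := increasing_of_derive Y w HYd Hw0).
assert (Hrw : forall a, rho (Y a) t * w a = rho0 a).
{ intros a; destruct (HpC a t ltac:(lra)) as [H _]; exact H. }
assert (Hphi : forall a, dx phi (Y a) t = C t - (N a - c * (Y a - a))).
{ intros a; destruct (HpC a t ltac:(lra)) as [_ H]; apply H; lra. }
clear HpC.
destruct HS as [[Hrho [Hrx [Hrxc _]]] _ _ Hp2 _ _ Hpois Hneut _ _ _].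
split.
- (* rho is C^1 at time t, hence so is the Jacobian rho0 / rho *)
  set (G := fun a => rho (Y a) t).
  set (dG := fun a => w a * dx rho (Y a) t).
  assert (HG0 : forall a, 0 < G a).
  { intros a; specialize (Hrw a); specialize (Hpos a); specialize (Hw0 a).
    unfold G; nra. }
  assert (HGd : forall a, is_derive G a (dG a)).
  { intros a; apply (is_derive_comp (fun y => rho y t) Y); [|apply HYd].
    apply Derive_correct, Hrx; lra. }
  assert (Hwc : continuity w).
  { intros a; unfold w, jacobian.
    pose proof (is_C1_continuity rho0 Hr0 a). pose proof (is_C1_continuity_derive u0 Hu0 a).
    repeat first [ assumption | apply continuity_pt_plus | apply continuity_pt_mult
      | apply continuity_pt_minus | const_pt ]. }
  set (df := fun a => ((Derive rho0 a * G a - rho0 a * dG a) / (G a * G a)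
                - Derive rho0 a * ((1 - y1 t) / c)) / y2 t).
  apply (is_C1_intro _ df).
  + intros a.
    assert (Hu0' : forall b,
      (rho0 b / G b - 1 - (rho0 b - c) * ((1 - y1 t) / c)) / y2 t = Derive u0 b).
    { intros b; specialize (HG0 b).
      replace (rho0 b / G b) with (w b)
        by (rewrite <- (Hrw b); unfold G in *; field; lra).
      unfold w, jacobian; field; lra. }
    apply (is_derive_ext (fun a => (rho0 a / G a - 1 - (rho0 a - c) * ((1 - y1 t) / c)) / y2 t)).
    * exact Hu0'.
    * pose proof (is_C1_derive rho0 a Hr0) as H1; specialize (HGd a).
      specialize (HG0 a).
      auto_derive.
      { repeat split; try (eexists; eassumption); lra. }
      rewrite (is_derive_unique (fun x : R => G x) _ _ HGd).
      unfold df; change (Derive (fun x => rho0 x) a) with (Derive rho0 a).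
      field; repeat split; lra.
  + assert (HGc : continuity G) by (intros a; eapply is_derive_continuity_pt, HGd).
    assert (HdG : continuity dG).
    { intros a; apply continuity_pt_mult; [apply Hwc|].
      apply (continuity_pt_comp Y (fun y => dx rho y t)); [apply HYc|].
      apply (continuous_strip_x T); [lra|exact Hrxc]. }
    intros a; unfold df, Rdiv.
    pose proof (is_C1_continuity rho0 Hr0 a); pose proof (is_C1_continuity_derive rho0 Hr0 a).
    specialize (HGc a); specialize (HdG a).
    repeat first [ assumption | apply continuity_pt_minus | apply continuity_pt_mult
      | const_pt ].
    apply continuity_pt_inv; [now apply continuity_pt_mult|].
    specialize (HG0 a); nra.
- set (h := fun y => - dx phi y t).
  assert (Hhd : forall y, is_derive h y (rho y t - c)).
  { intros y; apply (is_derive_eq _ _ (- dx (dx phi) y t)); [|now apply Hpois; lra].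
    apply (is_derive_opp (fun y => dx phi y t)).
    apply (Derive_correct (fun y => dx phi y t)), Hp2; lra. }
  destruct (proj1 (is_RInt_line_iff h (fun y => rho y t - c) Hhd
    ltac:(intros y; apply continuity_pt_minus;
          [apply (continuous_strip_x T); [lra|exact Hrho]|const_pt]))
    (Hneut t ltac:(lra))) as [l [Hlm Hlp]].
  destruct (proj1 (is_RInt_line_iff N (fun y => rho0 y - c) HNd Hr0c) Hneu)
    as [n [Hnm Hnp]].
  assert (HK : forall a, h (Y a) + c * Y a = N a + c * a - C t).
  { intros a; unfold h; rewrite Hphi; ring. }
  assert (HKc : continuity (fun y => h y + c * y)).
  { intros y; apply continuity_pt_plus; [eapply is_derive_continuity_pt, Hhd|].
    apply continuity_pt_mult; [const_pt|apply continuity_pt_id]. }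
  assert (HYp : is_lim Y p_infty p_infty).
  { apply (increasing_unbounded_p (fun y => h y + c * y) Y Hinc HKc).
    apply is_lim_spec; intros M.
    apply is_lim_spec in Hnp; destruct (Hnp (mkposreal 1 Rlt_0_1)) as [A HA].
    simpl in HA; exists (Rmax A ((M + C t + 1 - n) / c)); intros a Ha.
    rewrite HK.
    assert (H1 : A < a) by (eapply Rle_lt_trans; [apply Rmax_l|exact Ha]).
    assert (H2 : (M + C t + 1 - n) / c < a)
      by (eapply Rle_lt_trans; [apply Rmax_r|exact Ha]).
    apply Rmult_lt_compat_l with (r := c) in H2; [|exact hc].
    replace (c * ((M + C t + 1 - n) / c)) with (M + C t + 1 - n) in H2 by (field; lra).
    specialize (HA a H1); apply Rabs_def2 in HA; lra. }
  assert (HYm : is_lim Y m_infty m_infty).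
  { apply (increasing_unbounded_m (fun y => h y + c * y) Y Hinc HKc).
    apply is_lim_spec; intros M.
    apply is_lim_spec in Hnm; destruct (Hnm (mkposreal 1 Rlt_0_1)) as [A HA].
    simpl in HA; exists (Rmin A ((M + C t - 1 - n) / c)); intros a Ha.
    rewrite HK.
    assert (H1 : a < A) by (eapply Rlt_le_trans; [exact Ha|apply Rmin_l]).
    assert (H2 : a < (M + C t - 1 - n) / c)
      by (eapply Rlt_le_trans; [exact Ha|apply Rmin_r]).
    apply Rmult_lt_compat_l with (r := c) in H2; [|exact hc].
    replace (c * ((M + C t - 1 - n) / c)) with (M + C t - 1 - n) in H2 by (field; lra).
    specialize (HA a H1); apply Rabs_def2 in HA; lra. }
  (* u0 solved from the expression of Y and the relation HK *)
  set (A1 := - / (c * y2 t)); set (A2 := y1 t / (c * y2 t));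
  set (A3 := - (C t / c + p t) / y2 t).
  assert (Hu : forall a, A1 * h (Y a) + A2 * N a + A3 = u0 a).
  { intros a; pose proof (HK a) as H; unfold A1, A2, A3.
    replace (h (Y a)) with (N a + c * a - C t - c * Y a) by lra.
    unfold Y; field; lra. }
  exists (A1 * l + A2 * n + A3); split.
  + apply (is_lim_ext (fun a => A1 * h (Y a) + A2 * N a + A3)); [exact Hu|].
    apply is_lim_plus'; [apply is_lim_plus'|apply is_lim_const].
    * apply (is_lim_scal_l (fun a => h (Y a)) A1 m_infty l).
      apply (is_lim_comp h Y m_infty l m_infty Hlm HYm); now exists 0.
    * now apply (is_lim_scal_l N A2 m_infty n).
  + apply (is_lim_ext (fun a => A1 * h (Y a) + A2 * N a + A3)); [exact Hu|].
    apply is_lim_plus'; [apply is_lim_plus'|apply is_lim_const].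
    * apply (is_lim_scal_l (fun a => h (Y a)) A1 p_infty l).
      apply (is_lim_comp h Y p_infty l p_infty Hlp HYp); now exists 0.
    * now apply (is_lim_scal_l N A2 p_infty n).
Qed.

(** * Inverting a family of increasing maps *)

Lemma surjective_of_limits (f : R -> R) :
  continuity f -> is_lim f m_infty m_infty -> is_lim f p_infty p_infty ->
  forall y, exists x, f x = y.
Proof.
intros Hc Hm Hp y.
apply is_lim_spec in Hm; apply is_lim_spec in Hp.
destruct (Hm y) as [A HA], (Hp y) as [B HB].
specialize (HA (A - 1) ltac:(lra)); specialize (HB (B + 1) ltac:(lra)).
destruct (IVT_gen f (A - 1) (B + 1) y Hc) as [x [_ Hx]]; [|now exists x].
rewrite Rmin_left, Rmax_right by lra; lra.
Qed.

(** The implicit function theorem for a curve A known to be continuous: by the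
    mean value theorem the increment of A is the increment of f (A s0, .) divided
    by a value of w close to w (A s0, s0). *)
Lemma is_derive_implicit (f w : R -> R -> R) (A : R -> R) (s0 g : R) :
  locally s0 (fun s => f (A s) s = 0 /\ forall a, is_derive (fun b => f b s) a (w a s)) ->
  continuity_2d_pt w (A s0) s0 -> 0 < w (A s0) s0 ->
  is_derive (f (A s0)) s0 g -> continuity_pt A s0 ->
  is_derive A s0 (- g / w (A s0) s0).
Proof.
intros Hloc Hwc Hw0 Hg HA.
set (w0 := w (A s0) s0) in *; set (a0 := A s0) in *.
apply is_derive_Reals in Hg; apply is_derive_Reals; intros eps Heps.
set (M := (Rabs g + w0) / (w0 * (w0 / 2))).
assert (HM : 0 < M).
{ apply Rdiv_lt_0_compat; [pose proof (Rabs_pos g); lra|].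
  apply Rmult_lt_0_compat; lra. }
set (e := Rmin (w0 / 2) (eps / 2 / M)).
assert (He : 0 < e).
{ apply Rmin_pos; [lra|]. apply Rdiv_lt_0_compat; lra. }
assert (He1 : e <= w0 / 2) by apply Rmin_l.
assert (He2 : e * M <= eps / 2).
{ apply Rle_trans with (eps / 2 / M * M).
  - apply Rmult_le_compat_r; [lra|apply Rmin_r].
  - right; field; lra. }
destruct (Hg e He) as [d1 Hd1].
destruct (Hwc (mkposreal e He)) as [d2 Hd2]; simpl in Hd2.
destruct (proj1 (continuity_pt_locally _ _) HA d2) as [d3 Hd3].
destruct Hloc as [d4 Hd4].
assert (Hd : 0 < Rmin (Rmin d1 d2) (Rmin d3 d4)).
{ repeat apply Rmin_pos; apply cond_pos. }
exists (mkposreal _ Hd); simpl; intros h Hh0 Hh.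
assert (Hh1 : Rabs h < d1 /\ Rabs h < d2 /\ Rabs h < d3 /\ Rabs h < d4).
{ repeat split; (eapply Rlt_le_trans; [exact Hh|]).
  - eapply Rle_trans; apply Rmin_l.
  - eapply Rle_trans; [apply Rmin_l|apply Rmin_r].
  - eapply Rle_trans; [apply Rmin_r|apply Rmin_l].
  - eapply Rle_trans; apply Rmin_r. }
destruct Hh1 as [Hh1 [Hh2 [Hh3 Hh4]]].
assert (Hball : forall d : posreal, Rabs h < d -> ball s0 d (s0 + h)).
{ intros d Hd'; unfold ball; simpl; unfold AbsRing_ball, abs, minus, plus, opp; simpl.
  now replace (s0 + h + - s0) with h by ring. }
destruct (Hd4 (s0 + h) (Hball d4 Hh4)) as [Hf1 Hwd].
destruct (Hd4 s0 (ball_center s0 d4)) as [Hf0 _].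
specialize (Hd3 (s0 + h) (Hball d3 Hh3)); simpl in Hd3; fold a0 in Hd3.
specialize (Hd1 h Hh0 Hh1).
destruct (MVT_gen (fun b => f b (s0 + h)) a0 (A (s0 + h)) (fun b => w b (s0 + h)))
  as [xi [Hxi Hmv]].
{ intros; apply Hwd. }
{ intros; eapply is_derive_continuity_pt, Hwd. }
assert (Hxi' : Rabs (xi - a0) < d2).
{ apply Rabs_def2 in Hd3. unfold Rmin, Rmax in Hxi.
  destruct (Rle_dec a0 (A (s0 + h))); apply Rabs_def1; lra. }
assert (Hw : Rabs (w xi (s0 + h) - w0) < e).
{ apply Hd2; [exact Hxi'|]. now replace (s0 + h - s0) with h by ring. }
rewrite Hf1 in Hmv; fold a0 in Hf0; rewrite Hf0 in Hd1.
set (W := w xi (s0 + h)) in *; set (D := f a0 (s0 + h)) in *.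
assert (HW : w0 / 2 < W) by (apply Rabs_def2 in Hw; lra).
fold a0; replace ((A (s0 + h) - a0) / h - - g / w0) with
  ((g * (W - w0) - ((D - 0) / h - g) * w0) / (w0 * W)).
2:{ replace (A (s0 + h) - a0) with (- D / W); [field; lra|].
    apply Rmult_eq_reg_l with W; [|lra].
    rewrite <- Hmv; field; lra. }
assert (HwW : 0 < w0 * W) by (apply Rmult_lt_0_compat; lra).
set (num := g * (W - w0) - ((D - 0) / h - g) * w0).
rewrite Rabs_div, (Rabs_pos_eq (w0 * W)) by lra.
apply Rle_lt_trans with (e * M); [|lra].
apply Rmult_le_reg_r with (w0 * W); [exact HwW|].
replace (Rabs num / (w0 * W) * (w0 * W)) with (Rabs num) by (field; lra).
apply Rle_trans with (e * (Rabs g + w0)).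
- unfold num; eapply Rle_trans; [apply Rabs_triang|].
  rewrite Rabs_Ropp, !Rabs_mult, (Rabs_pos_eq w0) by lra.
  pose proof (Rabs_pos g).
  assert (Rabs g * Rabs (W - w0) <= Rabs g * e) by (apply Rmult_le_compat_l; lra).
  assert (Rabs ((D - 0) / h - g) * w0 <= e * w0) by (apply Rmult_le_compat_r; lra).
  lra.
- rewrite Rmult_assoc; apply Rmult_le_compat_l; [lra|].
  unfold M; pose proof (Rabs_pos g).
  replace (Rabs g + w0) with ((Rabs g + w0) / (w0 * (w0 / 2)) * (w0 * (w0 / 2))) at 1
    by (field; lra).
  apply Rmult_le_compat_l; [unfold M in HM; lra|].
  apply Rmult_le_compat_l; lra.
Qed.

(** The inverse in the first variable is defined with time frozen at 0 for
    negative times, so that it is continuous on the whole plane.  Its two partial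
    derivatives are both instances of [is_derive_implicit]. *)
Lemma inverse_flow (X w V : R -> R -> R) :
  (forall a t, continuity_2d_pt X a t) ->
  (forall a t, continuity_2d_pt w a t) ->
  (forall a t, is_derive (fun b => X b t) a (w a t)) ->
  (forall a t, is_derive (X a) t (V a t)) ->
  (forall a t, 0 <= t -> 0 < w a t) ->
  (forall t, 0 <= t -> is_lim (fun a => X a t) m_infty m_infty /\
                       is_lim (fun a => X a t) p_infty p_infty) ->
  exists A : R -> R -> R,
    (forall x t, 0 <= t -> X (A x t) t = x) /\
    (forall a t, 0 <= t -> A (X a t) t = a) /\
    (forall x t, continuity_2d_pt A x t) /\
    (forall x t, 0 <= t -> is_derive (fun y => A y t) x (/ w (A x t) t)) /\
    (forall x t, 0 < t -> is_derive (A x) t (- V (A x t) t / w (A x t) t)).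
Proof.
intros HXc Hwc HXa HXt Hw Hlim.
assert (Hp : forall t, 0 <= Rmax 0 t) by (intros; apply Rmax_l).
assert (Hex : forall x t, exists a, X a (Rmax 0 t) = x).
{ intros x t; destruct (Hlim _ (Hp t)) as [H1 H2].
  apply (surjective_of_limits (fun a => X a (Rmax 0 t))); auto.
  intros a; now apply continuity_pt_slice_x. }
set (A := fun x t => proj1_sig (constructive_indefinite_description _ (Hex x t))).
assert (HA : forall x t, X (A x t) (Rmax 0 t) = x).
{ intros x t; unfold A; now destruct constructive_indefinite_description. }
clearbody A.
assert (Hinc : forall t, 0 <= t -> forall a b, a < b -> X a t < X b t).
{ intros t Ht; apply (increasing_of_derive (fun a => X a t) (fun a => w a t)); auto. }
assert (Hlt : forall t, 0 <= t -> forall a b, X a t < X b t -> a < b).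
{ intros t Ht a b H; destruct (Rlt_le_dec a b) as [H'|[H'|H']]; [exact H'| |].
  - apply (Hinc t Ht) in H'; lra.
  - subst; lra. }
assert (HAc : forall x t, continuity_2d_pt A x t).
{ intros x t eps.
  set (a0 := A x t).
  assert (Hm : forall b, continuity_2d_pt (fun y s => X b (Rmax 0 s)) x t).
  { intros b; apply (continuity_2d_pt_snd (fun s => X b (Rmax 0 s))).
    apply (continuity_pt_comp (Rmax 0) (X b)).
    - apply (continuity_pt_ext (fun s => (0 + s + Rabs (0 - s)) / 2)).
      + intros s; unfold Rmax, Rabs; destruct (Rle_dec 0 s), Rcase_abs; lra.
      + repeat first [apply continuity_pt_plus | apply continuity_pt_mult
          | apply continuity_pt_id | const_pt].
        apply (continuity_pt_comp (fun s => 0 - s) Rabs); [|apply Rcontinuity_abs].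
        apply continuity_pt_minus; [const_pt|apply continuity_pt_id].
    - now apply continuity_pt_slice_t. }
  pose proof (cond_pos eps) as Heps.
  pose proof (HA x t) as Ha0; fold a0 in Ha0.
  destruct (locally_2d_pos (fun y s => y - X (a0 - eps) (Rmax 0 s)) x t) as [d1 Hd1].
  { apply continuity_2d_pt_minus; [apply continuity_2d_pt_id1|apply Hm]. }
  { pose proof (Hinc _ (Hp t) (a0 - eps) a0 ltac:(lra)); lra. }
  destruct (locally_2d_pos (fun y s => X (a0 + eps) (Rmax 0 s) - y) x t) as [d2 Hd2].
  { apply continuity_2d_pt_minus; [apply Hm|apply continuity_2d_pt_id1]. }
  { pose proof (Hinc _ (Hp t) a0 (a0 + eps) ltac:(lra)); lra. }
  exists (mkposreal _ (Rmin_pos _ _ (cond_pos d1) (cond_pos d2))); simpl.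
  intros y s Hy Hs.
  specialize (Hd1 y s (Rlt_le_trans _ _ _ Hy (Rmin_l _ _))
                (Rlt_le_trans _ _ _ Hs (Rmin_l _ _))).
  specialize (Hd2 y s (Rlt_le_trans _ _ _ Hy (Rmin_r _ _))
                (Rlt_le_trans _ _ _ Hs (Rmin_r _ _))).
  pose proof (HA y s) as Hys.
  assert (a0 - eps < A y s) by (apply (Hlt _ (Hp s)); lra).
  assert (A y s < a0 + eps) by (apply (Hlt _ (Hp s)); lra).
  apply Rabs_def1; lra. }
assert (HA' : forall x t, 0 <= t -> X (A x t) t = x).
{ intros x t Ht; rewrite <- (HA x t) at 2; now rewrite Rmax_right. }
exists A; split; [exact HA'|split; [|split; [exact HAc|split]]].
- intros a t Ht; pose proof (HA' (X a t) t Ht) as H.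
  destruct (Rtotal_order (A (X a t) t) a) as [H1|[H1|H1]]; [|exact H1|];
    apply (Hinc t Ht) in H1; lra.
- intros x t Ht.
  apply (is_derive_eq _ _ (- -1 / w (A x t) t)).
  2:{ specialize (Hw (A x t) t Ht); field; lra. }
  apply (is_derive_implicit (fun a y => X a t - y) (fun a _ => w a t) (fun y => A y t)).
  + apply filter_forall; intros y; split; [rewrite HA' by exact Ht; ring|].
    intros a; apply (is_derive_eq _ _ (w a t - 0)); [|ring].
    apply (is_derive_minus (fun b => X b t) (fun _ => y)); [apply HXa|].
    apply (is_derive_const (V := R_NormedModule)).
  + apply (continuity_2d_pt_fst (fun a => w a t)); now apply continuity_pt_slice_x.
  + now apply Hw.
  + auto_derive; [easy|ring].
  + now apply continuity_pt_slice_x.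
- intros x t Ht.
  apply (is_derive_implicit (fun a s => X a s - x) w (A x)).
  + eapply filter_imp; [|apply (locally_open_interval 0 (t + 1) t); lra].
    intros s Hs; split; [rewrite HA' by lra; ring|].
    intros a; apply (is_derive_eq _ _ (w a s - 0)); [|ring].
    apply (is_derive_minus (fun b => X b s) (fun _ => x)); [apply HXa|].
    apply (is_derive_const (V := R_NormedModule)).
  + apply Hwc.
  + apply Hw; lra.
  + apply (is_derive_eq _ _ (V (A x t) t - 0)); [|ring].
    apply (is_derive_minus (X (A x t)) (fun _ => x)); [apply HXt|].
    apply (is_derive_const (V := R_NormedModule)).
  + now apply continuity_pt_slice_t.
Qed.

(** * The global solution *)

Ltac cont_2d := repeat first
  [ assumption
  | match goal with H : forall x t, continuity_2d_pt ?f x t |- continuity_2d_pt ?f _ _ => apply H end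
  | apply continuity_2d_pt_fst; solve [auto]
  | apply continuity_2d_pt_snd; solve [auto]
  | apply continuity_2d_pt_const
  | apply continuity_2d_pt_id1
  | apply continuity_2d_pt_plus
  | apply continuity_2d_pt_minus
  | apply continuity_2d_pt_opp
  | apply continuity_2d_pt_mult ].

Lemma continuous_strip_of_2d T (f g : R -> R -> R) :
  (forall x t, 0 <= t -> continuity_2d_pt g x t) ->
  (forall x t, 0 <= t < T -> f x t = g x t) -> continuous_strip T f.
Proof.
intros Hg Hfg x t Ht; rewrite Hfg by exact Ht.
apply filterlim_within_ext with (f := fun p : R * R => g (fst p) (snd p)).
- intros [y s] Hs; symmetry; now apply Hfg.
- apply (filterlim_filter_le_1 (F := locally (x, t))).
  + intros P HP; unfold within; eapply filter_imp; [|exact HP]; auto.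
  + apply continuity_2d_pt_filterlim, Hg; lra.
Qed.

(** E0 is the initial field, the primitive of rho0 - c that vanishes at both
    ends, and L is the common limit of u0.  The background velocity
    L exp (- nu t) carries no field, so the velocity and the field at a label are
    damped oscillations started from u0 - L and E0. *)
Section GlobalSolution.

Variables (k c nu L : R) (y1 y2 rho0 u0 E0 : R -> R).
Hypotheses (hk : 0 < k) (hc : 0 < c) (hnu : 0 < nu).
Hypothesis HF : fundamental k c nu y1 y2.
Hypotheses (Hr0 : is_C1 rho0) (Hu0 : is_C1 u0) (Hu0' : is_C1 (Derive u0)).
Hypothesis HE0 : forall a, is_derive E0 a (rho0 a - c).
Hypothesis HE0lim : is_lim E0 m_infty 0 /\ is_lim E0 p_infty 0.
Hypothesis Hu0lim : is_lim u0 m_infty L /\ is_lim u0 p_infty L.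
Hypothesis Hjac : forall a t, 0 <= t -> 0 < jacobian c y1 y2 (rho0 a) (Derive u0 a) t.

Definition flow (a t : R) : R :=
  a + L * ((1 - exp (- nu * t)) / nu) + E0 a * ((1 - y1 t) / c) + (u0 a - L) * y2 t.

Definition flow_a (a t : R) : R := jacobian c y1 y2 (rho0 a) (Derive u0 a) t.

Definition flow_t (a t : R) : R :=
  L * exp (- nu * t) + E0 a * (k * y2 t) + (u0 a - L) * (y1 t - nu * y2 t).

Definition flow_aa (a t : R) : R :=
  Derive rho0 a * ((1 - y1 t) / c) + Derive (Derive u0) a * y2 t.

Definition flow_ta (a t : R) : R :=
  (rho0 a - c) * (k * y2 t) + Derive u0 a * (y1 t - nu * y2 t).

Definition flow_field (a t : R) : R := E0 a * y1 t - c * (u0 a - L) * y2 t.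

Definition flow_tt (a t : R) : R := - nu * flow_t a t + k * flow_field a t.

Ltac known_derivatives a t :=
  let H1 := fresh in let H2 := fresh in let H3 := fresh in let H4 := fresh in
  let H5 := fresh in let H6 := fresh in
  pose proof (fund_dy1 _ _ _ _ _ HF t) as H1;
  pose proof (fund_dy2 _ _ _ _ _ HF t) as H2;
  pose proof (HE0 a) as H3;
  pose proof (is_C1_derive rho0 a Hr0) as H4;
  pose proof (is_C1_derive u0 a Hu0) as H5;
  pose proof (is_C1_derive (Derive u0) a Hu0') as H6;
  auto_derive;
  [ repeat split; try (eexists; eassumption)
  | rewrite ?(is_derive_unique (fun x : R => y1 x) _ _ H1),
            ?(is_derive_unique (fun x : R => y2 x) _ _ H2),
            ?(is_derive_unique (fun x : R => E0 x) _ _ H3);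
    change (Derive (fun x => rho0 x) a) with (Derive rho0 a);
    change (Derive (fun x => u0 x) a) with (Derive u0 a);
    change (Derive (fun x => Derive u0 x) a) with (Derive (Derive u0) a) ].

Lemma flow_dx a t : is_derive (fun b => flow b t) a (flow_a a t).
Proof. unfold flow, flow_a, jacobian; known_derivatives a t; field; lra. Qed.

Lemma flow_dt a t : is_derive (flow a) t (flow_t a t).
Proof. unfold flow, flow_t; known_derivatives a t; field; lra. Qed.

Lemma flow_a_dx a t : is_derive (fun b => flow_a b t) a (flow_aa a t).
Proof. unfold flow_a, flow_aa, jacobian; known_derivatives a t; field; lra. Qed.

Lemma flow_a_dt a t : is_derive (flow_a a) t (flow_ta a t).
Proof. unfold flow_a, flow_ta, jacobian; known_derivatives a t; field; lra. Qed.

Lemma flow_t_dx a t : is_derive (fun b => flow_t b t) a (flow_ta a t).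
Proof. unfold flow_t, flow_ta; known_derivatives a t; ring. Qed.

Lemma flow_t_dt a t : is_derive (flow_t a) t (flow_tt a t).
Proof. unfold flow_tt, flow_field, flow_t; known_derivatives a t; ring. Qed.

Lemma flow_field_dx a t :
  is_derive (fun b => flow_field b t) a (rho0 a - c * flow_a a t).
Proof. unfold flow_field, flow_a, jacobian; known_derivatives a t; field; lra. Qed.

Lemma exp_decay_continuity : continuity (fun t => exp (- nu * t)).
Proof.
intros t; apply is_derive_continuity_pt with (- nu * exp (- nu * t)).
auto_derive; [easy|ring].
Qed.

Lemma E0_continuity : continuity E0.
Proof. intros a; eapply is_derive_continuity_pt, HE0. Qed.

Lemma flow_all_continuous a t :
  continuity_2d_pt flow a t /\ continuity_2d_pt flow_a a t /\
  continuity_2d_pt flow_t a t /\ continuity_2d_pt flow_aa a t /\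
  continuity_2d_pt flow_ta a t /\ continuity_2d_pt flow_field a t /\
  continuity_2d_pt flow_tt a t.
Proof.
destruct (fundamental_continuity _ _ _ _ _ HF) as [Hc1 Hc2].
pose proof exp_decay_continuity as Hexp; pose proof E0_continuity as HE0c.
pose proof (is_C1_continuity _ Hr0) as C1; pose proof (is_C1_continuity _ Hu0) as C2.
pose proof (is_C1_continuity _ Hu0') as C3.
pose proof (is_C1_continuity_derive _ Hr0) as C4.
pose proof (is_C1_continuity_derive _ Hu0') as C5.
assert (Hf : continuity_2d_pt flow_field a t) by (unfold flow_field; cont_2d).
assert (Ht : continuity_2d_pt flow_t a t) by (unfold flow_t; cont_2d).
unfold flow_tt, flow_a, jacobian, flow, flow_aa, flow_ta, Rdiv.
repeat split; cont_2d.
Qed.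

Lemma flow_lim t (x : Rbar) :
  x = m_infty \/ x = p_infty -> is_lim (fun a => flow a t) x x.
Proof.
intros Hx.
assert (HE : is_lim E0 x 0) by (destruct Hx; subst; apply HE0lim).
assert (HU : is_lim u0 x L) by (destruct Hx; subst; apply Hu0lim).
apply (is_lim_ext (fun a => a +
  ((L * ((1 - exp (- nu * t)) / nu) - L * y2 t) + ((1 - y1 t) / c * E0 a + y2 t * u0 a)))).
- intros a; unfold flow; ring.
- eapply is_lim_plus; [apply is_lim_id| |].
  + apply is_lim_plus'; [apply is_lim_const|].
    apply is_lim_plus'.
    * apply (is_lim_scal_l E0 ((1 - y1 t) / c) x 0 HE).
    * apply (is_lim_scal_l u0 (y2 t) x L HU).
  + destruct Hx; subst; reflexivity.
Qed.

Lemma flow_field_lim t (x : Rbar) :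
  x = m_infty \/ x = p_infty -> is_lim (fun a => flow_field a t) x 0.
Proof.
intros Hx.
assert (HE : is_lim E0 x 0) by (destruct Hx; subst; apply HE0lim).
assert (HU : is_lim u0 x L) by (destruct Hx; subst; apply Hu0lim).
apply (is_lim_ext (fun a => y1 t * E0 a + (- (c * y2 t)) * u0 a + c * L * y2 t)).
- intros a; unfold flow_field; ring.
- replace 0 with (y1 t * 0 + (- (c * y2 t)) * L + c * L * y2 t) by ring.
  apply is_lim_plus'; [|apply is_lim_const].
  apply is_lim_plus'.
  + apply (is_lim_scal_l E0 (y1 t) x 0 HE).
  + apply (is_lim_scal_l u0 (- (c * y2 t)) x L HU).
Qed.

(** Fields are transported as f (A (x, t), t), with A the inverse of the flow.
    Their derivatives follow from dA/dx = 1 / w and dA/dt = - X_t / w, and the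
    equations become identities between rational expressions in w.  Neutrality
    holds because the field tends to 0 at both ends in the label, hence also in
    x. *)
Lemma global_solution T :
  exists rho u phi, EP_solution k c nu rho0 u0 T rho u phi.
Proof.
assert (Cf := flow_all_continuous).
destruct (inverse_flow flow flow_a flow_t) as [A [HXA [HAX [HAc [HAx HAt]]]]];
  try (intros; apply Cf).
{ apply flow_dx. }
{ apply flow_dt. }
{ apply Hjac. }
{ intros t _; split; apply flow_lim; auto. }
assert (Hw : forall x t, 0 <= t -> 0 < flow_a (A x t) t) by (intros; now apply Hjac).
assert (Hcomp : forall f, (forall a t, continuity_2d_pt f a t) ->
          forall x t, continuity_2d_pt (fun y s => f (A y s) s) x t).
{ intros f Hf x t; apply (continuity_2d_pt_comp f A (fun _ s => s)); auto.
  apply continuity_2d_pt_id2. }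
assert (Hcw : forall x t, 0 <= t -> continuity_2d_pt (fun y s => / flow_a (A y s) s) x t).
{ intros x t Ht; apply (continuity_2d_pt_inv (fun y s => flow_a (A y s) s)).
  - apply Hcomp; intros; apply Cf.
  - specialize (Hw x t Ht); lra. }
assert (Hca : forall f, continuity f ->
          forall x t, continuity_2d_pt (fun y s => f (A y s)) x t).
{ intros f Hf; apply (Hcomp (fun a _ => f a)); intros.
  now apply continuity_2d_pt_fst. }
pose proof (Hca rho0 (is_C1_continuity _ Hr0)) as Cr0.
pose proof (Hca _ (is_C1_continuity_derive _ Hr0)) as Cr0'.
pose proof (Hcomp flow_a ltac:(intros; apply Cf)) as Ca.
pose proof (Hcomp flow_t ltac:(intros; apply Cf)) as Ct.
pose proof (Hcomp flow_aa ltac:(intros; apply Cf)) as Caa.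
pose proof (Hcomp flow_ta ltac:(intros; apply Cf)) as Cta.
pose proof (Hcomp flow_tt ltac:(intros; apply Cf)) as Ctt.
pose proof (Hcomp flow_field ltac:(intros; apply Cf)) as Cfield.
set (dens := fun a t => rho0 a / flow_a a t).
set (dens_a := fun a t =>
  (Derive rho0 a * flow_a a t - rho0 a * flow_aa a t) / (flow_a a t * flow_a a t)).
assert (Hdens_a : forall a t, 0 <= t ->
          is_derive (fun b => dens b t) a (dens_a a t)).
{ intros a t Ht; pose proof (is_C1_derive rho0 a Hr0) as H1.
  pose proof (flow_a_dx a t) as H2; pose proof (Hjac a t Ht) as H3.
  fold (flow_a a t) in H3; unfold dens; auto_derive.
  - repeat split; try (eexists; eassumption); lra.
  - rewrite (is_derive_unique (fun b : R => flow_a b t) _ _ H2).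
    change (Derive (fun x => rho0 x) a) with (Derive rho0 a).
    unfold dens_a; field; lra. }
assert (Hdens_t : forall a t, 0 <= t ->
  is_derive (dens a) t (- (rho0 a * flow_ta a t) / (flow_a a t * flow_a a t))).
{ intros a t Ht; pose proof (flow_a_dt a t) as H2; pose proof (Hjac a t Ht) as H3.
  fold (flow_a a t) in H3; unfold dens; auto_derive.
  - repeat split; try (eexists; eassumption); lra.
  - rewrite (is_derive_unique (fun s : R => flow_a a s) _ _ H2).
    field; lra. }
assert (Hdens_ac : forall a t, 0 <= t -> continuity_2d_pt dens_a a t).
{ intros a t Ht; destruct (Cf a t) as [_ [C1 [_ [C2 _]]]].
  pose proof (is_C1_continuity _ Hr0) as C3.
  pose proof (is_C1_continuity_derive _ Hr0) as C4.
  unfold dens_a, Rdiv; cont_2d.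
  apply continuity_2d_pt_inv; [cont_2d|].
  pose proof (Hjac a t Ht) as H3; fold (flow_a a t) in H3; nra. }
set (rho := fun x t => dens (A x t) t).
set (u := fun x t => flow_t (A x t) t).
set (E := fun x t => flow_field (A x t) t).
set (phi := (fun x t => - RInt (fun y => E y t) 0 x) : R -> R -> R).
set (rho_x := fun x t => / flow_a (A x t) t * dens_a (A x t) t).
set (u_x := fun x t => / flow_a (A x t) t * flow_ta (A x t) t).
set (rho_t := fun x t => dens_a (A x t) t * (- flow_t (A x t) t / flow_a (A x t) t)
  + - (rho0 (A x t) * flow_ta (A x t) t) / (flow_a (A x t) t * flow_a (A x t) t)).
set (u_t := fun x t => flow_ta (A x t) t * (- flow_t (A x t) t / flow_a (A x t) t)
  + flow_tt (A x t) t).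
assert (Hrx : forall x t, 0 <= t -> is_derive (fun y => rho y t) x (rho_x x t)).
{ intros x t Ht; apply (is_derive_comp (fun a => dens a t) (fun y => A y t)).
  - now apply Hdens_a.
  - now apply HAx. }
assert (Hux : forall x t, 0 <= t -> is_derive (fun y => u y t) x (u_x x t)).
{ intros x t Ht; apply (is_derive_comp (fun a => flow_t a t) (fun y => A y t)).
  - now apply flow_t_dx.
  - now apply HAx. }
assert (HEx : forall x t, 0 <= t -> is_derive (fun y => E y t) x (rho x t - c)).
{ intros x t Ht; apply (is_derive_eq _ _
    (/ flow_a (A x t) t * (rho0 (A x t) - c * flow_a (A x t) t))).
  - apply (is_derive_comp (fun a => flow_field a t) (fun y => A y t)).
    + now apply flow_field_dx.
    + now apply HAx.
  - specialize (Hw x t Ht); unfold rho, dens; field; lra. }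
assert (Hrt : forall x t, 0 < t -> is_derive (rho x) t (rho_t x t)).
{ intros x t Ht; apply (is_derive_comp_2d dens dens_a (A x)).
  - destruct (locally_open_interval 0 (t + 1) t ltac:(lra)) as [del Hdel].
    exists del; intros [a s] [_ Hs]; simpl in *.
    apply Hdens_a; specialize (Hdel s Hs); lra.
  - apply Hdens_ac; lra.
  - apply Hdens_t; lra.
  - now apply HAt. }
assert (Hut : forall x t, 0 < t -> is_derive (u x) t (u_t x t)).
{ intros x t Ht; apply (is_derive_comp_2d flow_t flow_ta (A x)).
  - apply filter_forall; intros [a s]; apply flow_t_dx.
  - apply Cf.
  - apply flow_t_dt.
  - now apply HAt. }
assert (Crho : forall x t, 0 <= t -> continuity_2d_pt rho x t).
{ intros x t Ht; specialize (Hcw x t Ht); unfold rho, dens, Rdiv; cont_2d. }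
assert (Cda : forall x t, 0 <= t -> continuity_2d_pt (fun y s => dens_a (A y s) s) x t).
{ intros x t Ht; apply (continuity_2d_pt_comp dens_a A (fun _ s => s)); auto.
  apply continuity_2d_pt_id2. }
assert (Cinv2 : forall x t, 0 <= t ->
   continuity_2d_pt (fun y s => / (flow_a (A y s) s * flow_a (A y s) s)) x t).
{ intros x t Ht.
  apply (continuity_2d_pt_inv (fun y s => flow_a (A y s) s * flow_a (A y s) s)).
  - now apply continuity_2d_pt_mult.
  - specialize (Hw x t Ht); nra. }
assert (Hphi : forall x t, is_derive (fun y => phi y t) x (- E x t)).
{ intros x t; apply (is_derive_opp (fun y => RInt (fun z => E z t) 0 y)).
  apply (is_derive_RInt_continuity (fun z => E z t)).
  intros y; now apply continuity_pt_slice_x. }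
assert (Hdphi : forall x t, dx phi x t = - E x t).
{ intros x t; apply is_derive_unique, Hphi. }
assert (Hdphi' : forall x t, 0 <= t -> is_derive (fun y => dx phi y t) x (- (rho x t - c))).
{ intros x t Ht; apply (is_derive_ext (fun y => - E y t)).
  - intros y; now rewrite Hdphi.
  - now apply (is_derive_opp (fun y => E y t)), HEx. }
assert (HAinc : forall t, 0 <= t -> forall x y, x < y -> A x t < A y t).
{ intros t Ht; apply (increasing_of_derive (fun x => A x t) (fun x => / flow_a (A x t) t)).
  - intros x; now apply HAx.
  - intros x; apply Rinv_0_lt_compat; auto. }
assert (HElim : forall t, 0 <= t ->
   is_lim (fun x => E x t) m_infty 0 /\ is_lim (fun x => E x t) p_infty 0).
{ intros t Ht; split.
  - apply (is_lim_comp (fun a => flow_field a t) (fun x => A x t) m_infty 0 m_infty).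
    + apply flow_field_lim; auto.
    + apply is_lim_spec; intros M; exists (flow M t); intros x Hx.
      rewrite <- (HAX M t Ht); now apply HAinc.
    + now exists 0.
  - apply (is_lim_comp (fun a => flow_field a t) (fun x => A x t) p_infty 0 p_infty).
    + apply flow_field_lim; auto.
    + apply is_lim_spec; intros M; exists (flow M t); intros x Hx.
      rewrite <- (HAX M t Ht); now apply HAinc.
    + now exists 0. }
assert (HA0 : forall x, A x 0 = x).
{ intros x; rewrite <- (HAX x 0) at 2 by lra; f_equal.
  unfold flow; rewrite (fund_y1_0 _ _ _ _ _ HF), (fund_y2_0 _ _ _ _ _ HF).
  rewrite Rmult_0_r, exp_0; field; lra. }
exists rho, u, phi; split.
- split; [|split; [|split]].
  + apply (continuous_strip_of_2d T rho rho); auto.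
  + intros x t Ht; exists (rho_x x t); apply Hrx; lra.
  + apply (continuous_strip_of_2d T (dx rho) rho_x).
    * intros x t Ht; apply continuity_2d_pt_mult; auto.
    * intros x t Ht; apply is_derive_unique, Hrx; lra.
  + exists rho_t; split.
    * apply (continuous_strip_of_2d T rho_t rho_t); auto.
      intros x t Ht; specialize (Hcw x t Ht); specialize (Cda x t Ht).
      specialize (Cinv2 x t Ht); unfold rho_t, Rdiv; cont_2d.
    * intros x t Ht; apply Hrt; lra.
- split; [|split; [|split]].
  + apply (continuous_strip_of_2d T u u); auto.
  + intros x t Ht; exists (u_x x t); apply Hux; lra.
  + apply (continuous_strip_of_2d T (dx u) u_x).
    * intros x t Ht; apply continuity_2d_pt_mult; auto.
    * intros x t Ht; apply is_derive_unique, Hux; lra.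
  + exists u_t; split.
    * apply (continuous_strip_of_2d T u_t u_t); auto.
      intros x t Ht; specialize (Hcw x t Ht); unfold u_t, Rdiv; cont_2d.
    * intros x t Ht; apply Hut; lra.
- intros x t _; eexists; apply Hphi.
- intros x t Ht; eexists; apply Hdphi'; lra.
- intros x t Ht.
  replace (dt rho x t) with (rho_t x t) by (symmetry; apply is_derive_unique, Hrt; lra).
  replace (dx (fun y s => rho y s * u y s) x t)
    with (rho_x x t * u x t + rho x t * u_x x t).
  2:{ symmetry; apply is_derive_unique.
      apply (is_derive_mult (fun y => rho y t) (fun y => u y t));
        [apply Hrx; lra|apply Hux; lra|intros; apply Rmult_comm]. }
  specialize (Hw x t ltac:(lra)).
  unfold rho_t, rho_x, u_x, rho, u, dens; field; lra.
- intros x t Ht.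
  replace (dt u x t) with (u_t x t) by (symmetry; apply is_derive_unique, Hut; lra).
  replace (dx u x t) with (u_x x t) by (symmetry; apply is_derive_unique, Hux; lra).
  rewrite Hdphi; specialize (Hw x t ltac:(lra)).
  unfold u_t, u_x, u, E, flow_tt; field; lra.
- intros x t Ht.
  replace (dx (dx phi) x t) with (- (rho x t - c))
    by (symmetry; apply is_derive_unique, Hdphi'; lra).
  ring.
- intros t Ht; apply (is_RInt_line_iff (fun x => E x t) (fun x => rho x t - c)).
  + intros x; apply HEx; lra.
  + intros x; apply continuity_pt_minus; [|const_pt].
    eapply is_derive_continuity_pt, Hrx; lra.
  + exists 0; apply HElim; lra.
- intros t Ht; apply (is_lim_ext (fun x => - E x t)); [intros; now rewrite Hdphi|].
  rewrite <- Ropp_0; apply (is_lim_opp (fun x => E x t) m_infty 0), HElim; lra.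
- intros x; unfold rho, dens; rewrite HA0; unfold flow_a, jacobian.
  rewrite (fund_y1_0 _ _ _ _ _ HF), (fund_y2_0 _ _ _ _ _ HF); field; lra.
- intros x; unfold u; rewrite HA0; unfold flow_t.
  rewrite (fund_y1_0 _ _ _ _ _ HF), (fund_y2_0 _ _ _ _ _ HF).
  rewrite Rmult_0_r, exp_0; ring.
Qed.

End GlobalSolution.

(** * Conclusion *)

(** The local solution supplies the regularity and the limits of the data from
    which the global one is built. *)
Lemma EP_solvable_all k c nu rho0 u0 y1 y2 :
  0 < k -> 0 < c -> 0 < nu -> is_C1 rho0 -> is_C1 u0 -> (forall x, 0 < rho0 x) ->
  is_RInt_line (fun x => rho0 x - c) 0 -> fundamental k c nu y1 y2 ->
  (exists T, EP_solvable k c nu rho0 u0 T) ->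
  (forall x, ~ collapses c y1 y2 (rho0 x) (Derive u0 x)) ->
  forall T, 0 < T -> EP_solvable k c nu rho0 u0 T.
Proof.
intros hk hc hnu Hr0 Hu0 Hpos Hneu HF [T0 [HT0 [rho [u [phi HS]]]]] Hno T HT.
destruct (EP_data_regular k c nu rho0 u0 T0 rho u phi y1 y2 hk hc HT0 Hr0 Hu0
  Hpos Hneu HS HF) as [Hu0' [L HL]].
set (N := (fun a => RInt (fun y => rho0 y - c) 0 a) : R -> R).
assert (Hr0c : continuity (fun y => rho0 y - c)).
{ intros y; apply continuity_pt_minus; [now apply is_C1_continuity|const_pt]. }
assert (HNd : forall a, is_derive N a (rho0 a - c)).
{ intros a; now apply (is_derive_RInt_continuity (fun y => rho0 y - c)). }
destruct (proj1 (is_RInt_line_iff N (fun y => rho0 y - c) HNd Hr0c) Hneu)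
  as [n [Hnm Hnp]].
split; [exact HT|].
apply (global_solution k c nu L y1 y2 rho0 u0 (fun a => N a - n)); auto.
- intros a; apply (is_derive_eq _ _ ((rho0 a - c) - 0)); [|ring].
  apply (is_derive_minus N (fun _ => n)); [apply HNd|].
  apply (is_derive_const (V := R_NormedModule)).
- rewrite <- (Rminus_eq_0 n).
  split; apply is_lim_minus'; auto; apply is_lim_const.
- intros a t Ht; apply Rnot_le_lt; intros H; apply (Hno a); now exists t.
Qed.

Theorem theorem2p2 (k c nu : R) (rho0 u0 : R -> R)
  (hk : 0 < k) (hc : 0 < c) (hnu : 0 < nu)
  (hrho0 : is_C1 rho0) (hu0 : is_C1 u0)
  (hpos : forall x, 0 < rho0 x)
  (hneutral : is_RInt_line (fun x => rho0 x - c) 0)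
  (hlocal : exists T, EP_solvable k c nu rho0 u0 T) :
  finite_time_breakdown k c nu rho0 u0 <->
  exists x : R,
    (nu > 2 * sqrt (k * c) ->
       strong_damping_condition k c nu (rho0 x) (Derive u0 x)) /\
    (nu = 2 * sqrt (k * c) ->
       borderline_damping_condition c nu (rho0 x) (Derive u0 x)) /\
    (nu < 2 * sqrt (k * c) ->
       weak_damping_condition k c nu (rho0 x) (Derive u0 x)).
Proof.
destruct (damping_collapse k c nu hk hc hnu) as [y1 [y2 [HF HC]]].
destruct (Lub_Rbar_correct (EP_solvable k c nu rho0 u0)) as [Hub Hlub].
fold (life_span k c nu rho0 u0) in Hub, Hlub.
unfold finite_time_breakdown.
transitivity (exists x, collapses c y1 y2 (rho0 x) (Derive u0 x)).
- split.
  + intros Hfin; apply NNPP; intros Hno.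
    assert (Hall := EP_solvable_all k c nu rho0 u0 y1 y2 hk hc hnu hrho0 hu0 hpos
      hneutral HF hlocal (fun x Hx => Hno (ex_intro _ x Hx))).
    rewrite <- Hfin in Hub.
    set (l := real (life_span k c nu rho0 u0)) in *.
    pose proof (Rle_abs l); pose proof (Rabs_pos l).
    assert (Hl : 0 < Rabs l + 1) by lra.
    specialize (Hub (Rabs l + 1) (Hall _ Hl)); simpl in Hub; lra.
  + intros [x [t [Ht Hx]]].
    destruct hlocal as [T0 HT0].
    apply is_finite_correct.
    assert (H1 := Hub T0 HT0).
    assert (H2 : Rbar_le (life_span k c nu rho0 u0) t).
    { apply Hlub; intros T [HT [rho [u [phi HS]]]]; simpl.
      destruct (Rle_lt_dec T t) as [H|H]; [exact H|exfalso].
      pose proof (EP_jacobian_pos k c nu rho0 u0 T rho u phi y1 y2 hk hc hrho0 hu0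
        hpos HS HF x t ltac:(lra)); lra. }
    destruct (life_span k c nu rho0 u0) as [l| |]; [now exists l|easy|easy].
- split; intros [x Hx]; exists x; now apply HC.
Qed.
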